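(* Let $n\ge 1$ and $s\ge 0$ be integers such that $s\le \lfloor \frac n3\rfloor+1$, and let $f,g$ be generic quadratic forms in $E_n$. Then the dimension over $\mathbb{C}$ of the $s$-th graded component of $E_n/(f,g)$ is equal to $$a(n,s)=\binom{n}{s}-2\binom{n}{s-2}+\binom{n}{s-4}.$$
   Context: $E_n$ is the exterior algebra over $\mathbb{C}$ on generators $x_1,\ldots,x_n$ of degree one. Forms are called generic if all their coefficients (of both forms, taken together) are mutually algebraically independent over $\mathbb{Q}$. Binomial coefficients $\binom{n}{j}$ with $j<0$ or $j>n$ are zero. For integers $n,s$ with $s\ge 0$, $a(n,s)$ denotes the number of lattice paths inside the rectangle $(n+2-2s)\times(n+2)$ (width $n+2-2s$, height $n+2$, boundary included) from the bottom left corner $(0,0)$ to the top right corner $(n+2-2s,n+2)$ with moves of two types: $(x,y)\to(x+1,y+1)$ or $(x,y)\to(x-1,y+1)$. If $n+2-2s<0$ then $a(n,s)=0$. *)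

(* Defs.v *)
From HB Require Import structures.
From mathcomp Require Import all_boot all_order all_algebra all_field.
From mathcomp Require Import generic_quotient ring_quotient.
From mathcomp Require Import reals complex mpoly.

Set Implicit Arguments.
Unset Strict Implicit.
Unset Printing Implicit Defensive.

Import GRing.Theory.
Local Open Scope ring_scope.
Local Open Scope quotient_scope.

Section Exterior.
Variables (K : fieldType) (n : nat).
Implicit Types A B C D : {set 'I_n}.

(* An element is its family of coordinates in the basis of the monomials
   x_A = x_(i1) * ... * x_(ik), with A = {i1 < ... < ik}. *)
Definition exterior := {ffun {set 'I_n} -> K^o}.

HB.instance Definition _ := Vector.copy exterior {ffun {set 'I_n} -> K^o}.

Implicit Types u v w : exterior.

Definition inversions A B : nat :=
  (\sum_(i in A) \sum_(j in B) (j < i)%N)%N.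

Definition ext_mono A : exterior := [ffun B => (B == A)%:R].
Definition ext_gen (i : 'I_n) : exterior := ext_mono [set i].
Definition ext_one : exterior := ext_mono set0.

(* x_A * x_B is 0 if A meets B, and (-1)^(inversions A B) x_(A :|: B) else. *)
Definition ext_mul u v : exterior :=
  [ffun C : {set 'I_n} => \sum_(A : {set 'I_n} | A \subset C)
     (-1) ^+ inversions A (C :\: A) * (u A * v (C :\: A)) : K].

Lemma inversionsUl A B C : [disjoint A & B] ->
  inversions (A :|: B) C = (inversions A C + inversions B C)%N.
Proof.
move=> AB; rewrite /inversions -bigU //=.
by apply: eq_bigl => i; rewrite !inE.
Qed.

Lemma inversionsUr A B C : [disjoint B & C] ->
  inversions A (B :|: C) = (inversions A B + inversions A C)%N.
Proof.
move=> BC; rewrite /inversions -big_split /=.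
apply: eq_bigr => i _; rewrite -bigU //=.
by apply: eq_bigl => j; rewrite !inE.
Qed.

Lemma inversions0l A : inversions set0 A = 0%N.
Proof. by rewrite /inversions big_set0. Qed.

Lemma inversions0r A : inversions A set0 = 0%N.
Proof. by rewrite /inversions big1 // => i _; rewrite big_set0. Qed.

Lemma ext_mulA : associative ext_mul.
Proof.
move=> u v w; apply/ffunP => D; rewrite !ffunE.
under eq_bigr => A AD.
  rewrite ffunE mulr_sumr mulr_sumr.
  over.
under [RHS]eq_bigr => C CD.
  rewrite ffunE mulr_suml mulr_sumr.
  over.
rewrite /= [RHS](exchange_big_dep (fun A => A \subset D)) /=; last first.
  by move=> C A CD sAC; apply: subset_trans sAC CD.
apply: eq_bigr => A AD.
rewrite (reindex_onto (fun C => C :\: A) (fun B => A :|: B)) /=; last first.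
  move=> B; rewrite subsetD => /andP[_ BA].
  by rewrite setDUl setDv set0U; apply/setDidPl.
have E C : (C :\: A \subset D :\: A) && (A :|: C :\: A == C)
         = (C \subset D) && (A \subset C).
  apply/andP/andP => [[CAD /eqP <-]|[CD sAC]].
    rewrite subsetUl subUset AD; split=> //.
    by apply: subset_trans CAD _; rewrite subsetDl.
  by rewrite setSD // -{2}(setID C A) (setIidPr sAC) eqxx.
apply: eq_big => // C /[1!E] /andP[CD sAC].
have -> : (D :\: A) :\: (C :\: A) = D :\: C.
  apply/setP => i; rewrite !inE; have := subsetP sAC i.
  by case: (i \in A) => [->|_] //=; rewrite ?andbF ?andbT.
have dC : [disjoint A & C :\: A].
  by rewrite disjoints_subset; apply/subsetP => i iA; rewrite !inE iA.
have dCD : [disjoint C :\: A & D :\: C].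
  by rewrite disjoints_subset; apply/subsetP => i; rewrite !inE => /andP[_ ->].
have DA : D :\: A = (C :\: A) :|: (D :\: C).
  apply/setP => i; rewrite !inE; move: (subsetP sAC i) (subsetP CD i).
  case: (i \in A); case: (i \in C); case: (i \in D) => // a b;
  by rewrite ?a ?b //; have := a isT.
have invC : inversions C (D :\: C)
    = (inversions A (D :\: C) + inversions (C :\: A) (D :\: C))%N.
  rewrite -inversionsUl //; congr (inversions _ _).
  by rewrite -{1}(setID C A) (setIidPr sAC).
rewrite DA inversionsUr // invC !exprD.
set a := _ ^+ inversions A (C :\: A); set b := _ ^+ inversions A _.
set c := _ ^+ inversions _ _.
rewrite [a * b]mulrC -!mulrA; congr (_ * _).
by rewrite [RHS]mulrCA; congr (_ * _); rewrite mulrCA.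
Qed.

Lemma ext_mul1l : left_id ext_one ext_mul.
Proof.
move=> u; apply/ffunP => C; rewrite ffunE (bigD1 set0) ?sub0set //= big1.
  by rewrite ffunE eqxx inversions0l expr0 !mul1r setD0 addr0.
by move=> A /andP[_ A0]; rewrite ffunE (negPf A0) mul0r mulr0.
Qed.

Lemma ext_mul1r : right_id ext_one ext_mul.
Proof.
move=> u; apply/ffunP => C; rewrite ffunE (bigD1 C) //= big1.
  by rewrite ffunE setDv eqxx inversions0r expr0 mul1r mulr1 addr0.
move=> A /andP[sAC neqAC]; rewrite ffunE setD_eq0 (_ : _ \subset _ = false).
  by rewrite mulr0 mulr0.
by apply: contraNF neqAC => sCA; rewrite eqEsubset sAC.
Qed.

Lemma ext_mulDl : left_distributive ext_mul +%R.
Proof.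
move=> u v w; apply/ffunP => C; rewrite !ffunE -big_split /=.
by apply: eq_bigr => A _; rewrite ffunE mulrDl mulrDr.
Qed.

Lemma ext_mulDr : right_distributive ext_mul +%R.
Proof.
move=> u v w; apply/ffunP => C; rewrite !ffunE -big_split /=.
by apply: eq_bigr => A _; rewrite ffunE !mulrDr.
Qed.

Lemma ext_one_neq0 : ext_one != 0.
Proof.
by apply/eqP => /ffunP/(_ set0); rewrite !ffunE eqxx => /eqP; rewrite oner_eq0.
Qed.

HB.instance Definition _ := GRing.Zmodule_isNzRing.Build exterior
  ext_mulA ext_mul1l ext_mul1r ext_mulDl ext_mulDr ext_one_neq0.

Lemma ext_scaleAl (a : K) u v : a *: (u * v) = (a *: u) * v.
Proof.
apply/ffunP => C; rewrite !ffunE scaler_sumr.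
by apply: eq_bigr => A _; rewrite ffunE /GRing.scale /= mulrCA !mulrA.
Qed.

HB.instance Definition _ := GRing.Lmodule_isLalgebra.Build K exterior ext_scaleAl.

Lemma ext_scaleAr (a : K) u v : a *: (u * v) = u * (a *: v).
Proof.
apply/ffunP => C; rewrite !ffunE scaler_sumr.
apply: eq_bigr => A _; rewrite ffunE /GRing.scale /= mulrCA.
by congr (_ * _); rewrite mulrCA.
Qed.

HB.instance Definition _ := GRing.Lalgebra_isAlgebra.Build K exterior ext_scaleAr.
HB.instance Definition _ := Algebra_isFalgebra.Build K exterior.
End Exterior.

Section ExteriorTheory.
Variables (K : fieldType) (n : nat).
Implicit Types A B : {set 'I_n}.

Lemma ext_monoM A B : ext_mono K A * ext_mono K B =
  if [disjoint A & B] then (-1) ^+ inversions A B *: ext_mono K (A :|: B) else 0.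
Proof.
apply/ffunP => C; rewrite ffunE (bigID (pred1 A)) /= [X in _ + X]big1 ?addr0.
  have [sAC|nsAC] := boolP (A \subset C); last first.
    rewrite big_pred0 => [|D]; last first.
      by apply/negbTE; apply: contra nsAC => /andP[DC /eqP <-].
    case: ifP => _; rewrite !ffunE // (_ : C == _ = false) ?scaler0 //.
    by apply: contraNF nsAC => /eqP ->; rewrite subsetUl.
  rewrite (big_pred1 A) => [|D]; last by rewrite andb_idl // => /eqP ->.
  rewrite !ffunE eqxx mul1r; have [EB|neq] := eqVneq (C :\: A) B.
    have dAB : [disjoint A & B].
      by rewrite -EB disjoints_subset; apply/subsetP => i iA; rewrite !inE iA.
    rewrite dAB !ffunE -{2}EB; have -> : A :|: C :\: A = C.
      by rewrite -{2}(setID C A) (setIidPr sAC).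
    by rewrite eqxx EB.
  rewrite mulr0; case: ifP => dAB; rewrite !ffunE //.
  rewrite (_ : C == _ = false) ?scaler0 //.
  apply: contraNF neq => /eqP ->; apply/eqP.
  by rewrite setDUl setDv set0U; apply/setDidPl; rewrite disjoint_sym.
by move=> D /andP[_ /negPf nDA]; rewrite ffunE nDA mul0r mulr0.
Qed.

Lemma inversions1 (i j : 'I_n) : inversions [set i] [set j] = (j < i)%N.
Proof. by rewrite /inversions !big_set1. Qed.

Lemma ext_gen_sqr (i : 'I_n) : ext_gen K i * ext_gen K i = 0.
Proof. by rewrite ext_monoM disjoints1 inE eqxx. Qed.

Lemma ext_gen_anticomm (i j : 'I_n) :
  ext_gen K i * ext_gen K j = - (ext_gen K j * ext_gen K i).
Proof.
have [->|ij] := eqVneq i j; first by rewrite ext_gen_sqr oppr0.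
rewrite !ext_monoM !disjoints1 !inE ij eq_sym ij !inversions1 setUC.
rewrite -scaleNr; congr (_ *: _); have : val i != val j by [].
by case: ltngtP => //= _ _; rewrite ?expr0 ?expr1 ?opprK.
Qed.

Lemma ext_mono_prod A : ext_mono K A = \prod_(i <- enum A) ext_gen K i.
Proof.
have : sorted ltn (map val (enum A)).
  rewrite sorted_map; apply: sorted_filter.
    by move=> ? ? ?; apply: ltn_trans.
  by rewrite -enumT -(sorted_map (f := val)) val_enum_ord iota_ltn_sorted.
have -> : ext_mono K A = ext_mono K [set x in enum A].
  by congr ext_mono; apply/setP => i; rewrite inE mem_enum.
elim: (enum A) => [|i s IHs] /=.
  by rewrite big_nil; move=> _; congr ext_mono; apply/setP => i; rewrite !inE.
rewrite (path_sortedE ltn_trans) => /andP[/allP i_lt /IHs IH].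
have lt_i j : j \in s -> (i < j)%N by move=> js; apply: i_lt; apply: map_f.
have i_s : i \notin s by apply/negP => /lt_i; rewrite ltnn.
rewrite big_cons -IH ext_monoM disjoints1 inE i_s.
rewrite (_ : inversions _ _ = 0%N) ?expr0 ?scale1r.
  by congr ext_mono; apply/setP => j; rewrite !inE.
rewrite /inversions big_set1 big1 // => j; rewrite inE => /lt_i ij.
by rewrite ltnNge ltnW.
Qed.
End ExteriorTheory.

Section QuotientSpace.
Import VectorInternalTheory.
Variables (K : fieldType) (vT : vectType K).

Definition vquot (U : {vspace vT}) : Type := Quotient.quot U.

Variable U : {vspace vT}.
Local Notation Q := (vquot U).

HB.instance Definition _ :=
  ZmodQuotient.copy Q (Quotient.quot U).

Implicit Types (x y : Q) (a b : K).

Lemma vquot_eq (v w : vT) : (\pi_Q v == \pi_Q w) = (v - w \in U).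
Proof. by rewrite -Quotient.idealrBE. Qed.

Definition vquot_scale a : Q -> Q := lift_op1 Q ( *:%R a).

Lemma vquot_scale_pi a v : vquot_scale a (\pi_Q v) = \pi_Q (a *: v).
Proof.
unlock vquot_scale; apply/eqP; rewrite vquot_eq -scalerBr rpredZ //.
by rewrite -vquot_eq reprK.
Qed.

Lemma vquot_scaleA a b x :
  vquot_scale a (vquot_scale b x) = vquot_scale (a * b) x.
Proof. by elim/quotP: x => v _; rewrite !vquot_scale_pi scalerA. Qed.

Lemma vquot_scale1 : left_id 1 vquot_scale.
Proof. by elim/quotP => v _; rewrite vquot_scale_pi scale1r. Qed.

Lemma vquot_scaleDr : right_distributive vquot_scale +%R.
Proof.
move=> a; elim/quotP => v _; elim/quotP => w _.
by rewrite -raddfD !vquot_scale_pi -raddfD scalerDr.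
Qed.

Lemma vquot_scaleDl x : {morph vquot_scale^~ x : a b / a + b}.
Proof.
by elim/quotP: x => v _ a b; rewrite !vquot_scale_pi -raddfD scalerDl.
Qed.

HB.instance Definition _ := GRing.Zmodule_isLmodule.Build K Q
  vquot_scaleA vquot_scale1 vquot_scaleDr vquot_scaleDl.

Definition vquot_pi (v : vT) : Q := \pi_Q v.

Lemma vquot_pi_is_linear : linear vquot_pi.
Proof. by move=> a v w; rewrite /vquot_pi raddfD /= -vquot_scale_pi. Qed.

HB.instance Definition _ :=
  GRing.isLinear.Build K vT Q *:%R vquot_pi vquot_pi_is_linear.

Lemma vquot_piK x : vquot_pi (repr x) = x.
Proof. exact: reprK. Qed.

Lemma vquot_vect_axiom : Vector.axiom (\dim U^C) Q.
Proof.
have UC0 : (U^C :&: U = 0)%VS by rewrite capvC capv_compl.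
pose p := daddv_pi U^C U.
have pU v : v \in U -> p v = 0.
  move=> Uv; have := daddv_pi_add UC0 (w := v).
  rewrite addvC addv_complf memvf => /(_ isT).
  by rewrite (daddv_pi_id _ Uv) 1?capvC // -[RHS]add0r => /addIr.
have pE v w : vquot_pi v = vquot_pi w -> p v = p w.
  by move=> /eqP; rewrite vquot_eq => /pU /eqP; rewrite linearB subr_eq0 => /eqP.
have pK v : vquot_pi (p v) = vquot_pi v.
  apply/eqP; rewrite vquot_eq.
  have := daddv_pi_add UC0 (w := v).
  rewrite addvC addv_complf memvf => /(_ isT) {2}<-.
  by rewrite opprD addrA subrr sub0r rpredN memv_pi.
pose f (x : Q) : 'rV_(\dim U^C) := v2r (vsproj U^C (p (repr x))).
exists f.
  move=> a x y; rewrite /f.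
  have -> : p (repr (a *: x + y)) = a *: p (repr x) + p (repr y).
    rewrite -(linearP p); apply: pE.
    by rewrite (linearP vquot_pi) /= !vquot_piK.
  by rewrite !linearP.
exists (fun r => vquot_pi (vsval (r2v r : subvs_of U^C))) => [x|r].
  by rewrite /f v2rK vsprojK ?memv_pi // pK vquot_piK.
rewrite /f (pE _ (vsval (r2v r : subvs_of U^C))) ?vquot_piK //.
by rewrite /p daddv_pi_id ?subvsP // vsvalK r2vK.
Qed.

HB.instance Definition _ := Lmodule_hasFinDim.Build K Q vquot_vect_axiom.
End QuotientSpace.

Section GradedQuotients.
Variables (K : fieldType) (n : nat).
Local Notation E := (exterior K n).

Definition ext_homog (d : nat) : {vspace E} :=
  <<[seq ext_mono K A | A : {set 'I_n} in [set A : {set 'I_n} | #|A| == d]]>>%VS.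

(* The two-sided ideal generated by rs, as the span of all u * r * v. *)
Definition ext_ideal (rs : seq E) : {vspace E} :=
  (fullv * <<rs>> * fullv)%VS.

(* The degree d component of E / I, for a homogeneous ideal I. *)
Definition ext_quot_homog (I : {vspace E}) (d : nat) : {vspace vquot I} :=
  (linfun (vquot_pi I) @: ext_homog d)%VS.
End GradedQuotients.

Definition alg_independent (K : numFieldType) (I : finType) (c : I -> K) : Prop :=
  forall p : {mpoly rat[#|I|]},
    (map_mpoly ratr p).@[fun i => c (enum_val i)] = 0 -> p = 0.

Definition quad_mono (n : nat) := {A : {set 'I_n} | #|A| == 2}.

(* All coefficients of f and g together, as one family indexed by two disjoint
   copies of the set of quadratic monomials. *)
Definition quad_coefs (K : fieldType) (n : nat) (f g : exterior K n)
    (m : quad_mono n + quad_mono n) : K :=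
  match m with
  | inl A => f (val A)
  | inr A => g (val A)
  end.

Definition generic_quadratic_forms (K : numFieldType) (n : nat)
    (f g : exterior K n) : Prop :=
  [/\ f \in ext_homog K n 2, g \in ext_homog K n 2
    & alg_independent (quad_coefs f g)].

Definition in_rectangle (w h : int) (p : int * int) : bool :=
  (0 <= p.1 <= w) && (0 <= p.2 <= h).

Definition path_step (p : int * int) (right : bool) : int * int :=
  ((if right then p.1 + 1 else p.1 - 1), p.2 + 1).

(* The width n + 2 - 2s may be negative: then even the start is not in the
   rectangle and the count is 0. Every move raises the second coordinate by 1,
   so the paths from height 0 to height n + 2 are those with n + 2 moves. *)
Definition lattice_paths (n s : nat) : nat :=
  let w := n%:Z + 2 - 2 * s%:Z in
  let h := n%:Z + 2 in
  #|[set m : (n + 2).-tuple bool |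
      all (in_rectangle w h) ((0, 0) :: scanl path_step (0, 0) m)
      && (foldl path_step (0, 0) m == (w, h))]|.

(* Unlike 'C(n, _) with truncated subtraction, this vanishes for j < 0. *)
Definition binomz (n : nat) (j : int) : nat :=
  if j is Posz k then 'C(n, k) else 0.

(* Main.v *)
Require Import Defs.
From HB Require Import structures.
From mathcomp Require Import all_boot all_order all_algebra all_field.
From mathcomp Require Import boolp functions.
From mathcomp Require Import reals complex mpoly.
From mathcomp Require Import ring lra zify.

(** Write E for the exterior algebra.  Both equalities compute the coefficient
    of X^s in (1 + X)^n (1 - X^2)^2.

    For lattice paths this is the method of images.  A path confined to the
    strip is counted by an alternating sum of numbers of free walks, one for
    each image of the end point under the reflections in the two forbidden
    lines.  The hypothesis on [s] says exactly that all but four images are too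
    far away to be reached from the origin, and the remaining ones give
    C(n+2, s) - 2 C(n+2, s-1) + C(n+2, s-2) ([lattice_paths_binomz]).

    For the quotient, the number is the Euler characteristic of the strand
    E_(s-4) -> E_(s-2) + E_(s-2) -> E_s of the Koszul complex of [f] and [g],
    whose maps send c to (c g, - c f) and (a, b) to a f + b g; its cokernel is
    the space in question.  So the strand has to be exact on the left and in the
    middle.  A matrix with polynomial entries has at an algebraically
    independent point at least the rank that it has at any rational point
    ([rank_specialize]), and the two ranks cannot exceed what exactness
    requires, because the composite vanishes.  Hence one pair of forms with
    rational coefficients and an exact strand is enough ([generic_rank]).

    That pair is built from t = n / 3 blocks of three consecutive variables:
    f0 is the sum of the x_(3i) x_(3i+1) and g0 the sum of the
    x_(3i+1) x_(3i+2).  Products of two adjacent variables multiply monomials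
    without signs.  Let F and G be the multiplications by f0 and g0.  On one
    block, with variables x, y, z, the exterior algebra splits under F and G
    into the module spanned by 1, xy, yz, its dual spanned by x, z, xyz, and the
    two lines spanned by y and xz, which F and G kill.

    One inducts on the number of blocks.  Exactness alone does not carry over:
    after tensoring with the span of 1, xy, yz, the relations between the
    generators of the j-th power of the ideal (F, G) involve those of its powers
    j + 1 and j - 1.  What carries over is the statement [lin_syz] about all the
    powers at once: if a_0, ..., a_j have degree at most t - j and the sum of the
    F^(j-i) G^i a_i vanishes, then a_i = G b_(i+1) - F b_i for some b with
    b_0 = b_(j+1) = 0.  The step is [lin_syz_gen] for the first summand and
    [lin_syz_cog] for the second; they are assembled in [lin_syz_bits].  The case
    j = 1 is the exactness of the strand for s at most t + 1. *)

Set Implicit Arguments.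
Unset Strict Implicit.
Unset Printing Implicit Defensive.
Import Order.TTheory GRing.Theory Num.Theory.

Local Open Scope ring_scope.

(** * Lattice paths in a strip *)

Lemma binomzS n j : (binomz n.+1 j = binomz n j + binomz n (j - 1))%N.
Proof.
case: j => [[|j]|j]; first by rewrite /= !bin0.
  by rewrite (_ : j.+1%:Z - 1 = j%:Z); [rewrite /= binS | lia].
by rewrite (_ : Negz j - 1 = Negz j.+1) //; lia.
Qed.

Fixpoint walks (k : nat) (y : int) : int :=
  if k is k'.+1 then walks k' (y - 1) + walks k' (y + 1) else (y == 0)%:R.

Lemma walks_far k y : k%:Z < y -> walks k y = 0.
Proof.
elim: k y => [|k IHk] y ky /=; first by case: eqP => //; lia.
by rewrite !IHk //; lia.
Qed.

Lemma walksN k y : walks k (- y) = walks k y.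
Proof.
elim: k y => [|k IHk] y /=; first by rewrite oppr_eq0.
rewrite addrC (_ : - y + 1 = - (y - 1)); last by ring.
by rewrite (_ : - y - 1 = - (y + 1)) ?IHk //; ring.
Qed.

Lemma walks_binomz k j : walks k (k%:Z - 2 * j) = (binomz k j)%:Z.
Proof.
elim: k j => [|k IHk] j.
  rewrite /= (_ : (0 - 2 * j == 0) = (j == 0)); last by lia.
  by case: j => [[|j]|j].
rewrite /= binomzS PoszD -!IHk; congr (walks _ _ + walks _ _); lia.
Qed.

Section Strip.
Variables w h : int.
Hypothesis w0 : 0 <= w.

Definition confined (p : int * int) (m : seq bool) :=
  all (in_rectangle w h) (p :: scanl path_step p m) &&
  (foldl path_step p m == (w, h)).

Definition confined_count k p := #|[set m : k.-tuple bool | confined p m]|.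

Lemma confined_count0 p : confined_count 0 p = confined p [::].
Proof.
rewrite /confined_count cardsE; case: (boolP (confined p [::])) => cp.
  transitivity #|{: 0.-tuple bool}|; last by rewrite card_tuple expn0.
  by apply: eq_card => m; rewrite tuple0 !inE.
by apply: eq_card0 => m; rewrite tuple0 !inE; apply: negbTE.
Qed.

Lemma confined_countS k p : confined_count k.+1 p =
  if in_rectangle w h p then
    (confined_count k (path_step p true) + confined_count k (path_step p false))%N
  else 0%N.
Proof.
rewrite /confined_count -!sum1dep_card big_mkcond /=.
rewrite (reindex (fun bm : bool * k.-tuple bool =>
  [tuple of bm.1 :: bm.2])) /=; last first.
  exists (fun m : k.+1.-tuple bool => (thead m, [tuple of behead m])) => [[b m] _|m _].
    by congr pair; apply: val_inj.
  by rewrite -tuple_eta.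
rewrite -(pair_bigA _ (fun (b : bool) (m : k.-tuple bool) =>
  if confined p (b :: m) then 1%N else 0%N)) /=.
rewrite big_bool /= -!big_mkcond /=; case: ifP => pin.
  by congr (_ + _)%N; apply: eq_bigl => m; rewrite /confined /= pin.
by rewrite !big_pred0 // => m; rewrite /confined /= pin.
Qed.

(** The images of the end point [w] under the group generated by the reflections
    in -1 and [w + 1], each with its sign, as far as they can be reached from the
    strip in fewer than [3 * w + 5] steps. *)
Definition images k x : int :=
  walks k (w - x) + walks k (x + w + 4) + walks k (3 * w + 4 - x)
  - walks k (x + w + 2) - walks k (w + 2 - x) - walks k (3 * w + 6 - x).

Lemma images_rec k x : images k.+1 x = images k (x + 1) + images k (x - 1).
Proof.
have W y a b : y - 1 = a -> y + 1 = b -> walks k.+1 y = walks k a + walks k b.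
  by move=> <- <-.
rewrite /images (W (w - x) (w - (x + 1)) (w - (x - 1))); try ring.
rewrite (W (x + w + 4) (x - 1 + w + 4) (x + 1 + w + 4)); try ring.
rewrite (W (3 * w + 4 - x) (3 * w + 4 - (x + 1)) (3 * w + 4 - (x - 1))); try ring.
rewrite (W (x + w + 2) (x - 1 + w + 2) (x + 1 + w + 2)); try ring.
rewrite (W (w + 2 - x) (w + 2 - (x + 1)) (w + 2 - (x - 1))); try ring.
rewrite (W (3 * w + 6 - x) (3 * w + 6 - (x + 1)) (3 * w + 6 - (x - 1))); try ring.
Qed.

Lemma images_left k : k%:Z < 3 * w + 5 -> images k (- 1) = 0.
Proof.
move=> kw; rewrite /images [walks k (3 * w + 4 - -1)]walks_far; last by lia.
rewrite [walks k (3 * w + 6 - -1)]walks_far; last by lia.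
rewrite (_ : w - -1 = -1 + w + 2); last by ring.
by rewrite (_ : w + 2 - -1 = -1 + w + 4); ring.
Qed.

Lemma images_right k : images k (w + 1) = 0.
Proof.
rewrite /images (_ : w - (w + 1) = - (w + 2 - (w + 1))); last by ring.
rewrite walksN (_ : w + 1 + w + 4 = 3 * w + 6 - (w + 1)); last by ring.
by rewrite (_ : w + 1 + w + 2 = 3 * w + 4 - (w + 1)); ring.
Qed.

Lemma images0 x : 0 <= x <= w -> images 0 x = (x == w)%:R.
Proof.
move=> /andP[x0 xw]; rewrite /images.
rewrite [walks _ (x + w + 4)]walks_far; last by lia.
rewrite [walks _ (3 * w + 4 - x)]walks_far; last by lia.
rewrite [walks _ (x + w + 2)]walks_far; last by lia.
rewrite [walks _ (w + 2 - x)]walks_far; last by lia.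
rewrite [walks _ (3 * w + 6 - x)]walks_far; last by lia.
by rewrite /= subr_eq0 eq_sym; ring.
Qed.

(** Both sides satisfy the recursion of free walks inside the strip, agree for
    walks without steps, and vanish on the two lines just outside.  The bound on
    [k] is what makes the truncated sum of images vanish at -1. *)
Lemma confined_countE k (x y : int) : k%:Z < 3 * w + 5 -> y + k%:Z = h -> 0 <= y ->
  -1 <= x <= w + 1 -> (confined_count k (x, y))%:Z = images k x.
Proof.
elim: k x y => [|k IHk] x y kw yh y0 /andP[x1 xw].
  rewrite confined_count0 /confined /= andbT /in_rectangle /=.
  case: (boolP (0 <= x <= w)) => [xin|xout].
    rewrite images0 // xpair_eqE -yh addr0 eqxx andbT y0 lexx /=.
    by case: eqP.
  have [->|->] : x = -1 \/ x = w + 1 by lia.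
    by rewrite images_left.
  by rewrite images_right.
rewrite confined_countS /in_rectangle /=.
have -> : (0 <= y <= h) by lia.
rewrite andbT; case: (boolP (0 <= x <= w)) => [xin|xout].
  by rewrite PoszD !IHk ?images_rec //=; lia.
have [->|->] : x = -1 \/ x = w + 1 by lia.
  by rewrite images_left.
by rewrite images_right.
Qed.
End Strip.

(** The bound on [s] puts the images at distance [3 * w + 4] or more out of reach
    of [n + 2] steps. *)
Lemma lattice_paths_binomz n s : (3 * s <= n + 3)%N ->
  (lattice_paths n s)%:Z = (binomz n s%:Z)%:Z - 2 * (binomz n (s%:Z - 2))%:Z
      + (binomz n (s%:Z - 4))%:Z.
Proof.
move=> sn; set w := n%:Z + 2 - 2 * s%:Z.
transitivity (images w (n + 2) 0).
  rewrite -(@confined_countE w (n%:Z + 2) _ _ 0 0) //; rewrite /w; lia.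
have W k j : k = (n + 2)%:Z - 2 * j -> walks (n + 2) k = (binomz (n + 2) j)%:Z.
  by move=> ->; apply: walks_binomz.
rewrite /images (W _ s%:Z) ?(W (0 + w + 4) (s%:Z - 2)) ?(W (0 + w + 2) (s%:Z - 1))
  ?(W (w + 2 - 0) (s%:Z - 1)); try by rewrite /w; lia.
rewrite !walks_far; try by rewrite /w; lia.
rewrite addn2 !binomzS !PoszD.
rewrite (_ : s%:Z - 1 - 1 = s%:Z - 2); last by ring.
rewrite (_ : s%:Z - 2 - 1 - 1 = s%:Z - 4); last by ring.
by rewrite (_ : s%:Z - 2 - 1 = s%:Z - 3); ring.
Qed.

(** * Linear syzygies of two commuting operators *)

Section Pencil.
Variable K : numFieldType.

(** Homogeneous elements of a given degree are the functions supported on the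
    indices of that degree. *)
Definition supported (I : Type) (S : pred I) (u : I -> K^o) : Prop :=
  forall x, u x != 0 -> S x.

Lemma supported0 (I : Type) (S : pred I) : supported S 0.
Proof. by move=> x /eqP. Qed.

Lemma supported_lin (I : Type) (S : pred I) (c : K) (u v : I -> K^o) :
  supported S u -> supported S v -> supported S (c *: u + v).
Proof.
move=> Su Sv x; apply: contraNT => nSx.
have {Su}: u x == 0 by apply: contraNT nSx => /Su.
have {Sv}: v x == 0 by apply: contraNT nSx => /Sv.
by move=> /eqP v0 /eqP u0; rewrite !fctE u0 v0 scaler0 addr0.
Qed.

Lemma supportedZ (I : Type) (S : pred I) (c : K) (u : I -> K^o) :
  supported S u -> supported S (c *: u).
Proof.
by move=> Su; rewrite -[_ *: _]addr0; apply: supported_lin Su (supported0 S).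
Qed.

Lemma supportedD (I : Type) (S : pred I) (u v : I -> K^o) :
  supported S u -> supported S v -> supported S (u + v).
Proof. by move=> Su; rewrite -[u]scale1r; apply: supported_lin Su. Qed.

Lemma supportedN (I : Type) (S : pred I) (u : I -> K^o) :
  supported S u -> supported S (- u).
Proof. by rewrite -scaleN1r; apply: supportedZ. Qed.

Lemma supportedB (I : Type) (S : pred I) (u v : I -> K^o) :
  supported S u -> supported S v -> supported S (u - v).
Proof. by move=> Su Sv; apply: supportedD Su (supportedN Sv). Qed.

(** A graded module over the polynomial ring in two variables of degree 2, given
    by a basis, with formally infinite sums allowed.  Using functions on an index
    type instead of an abstract module reduces identities between vectors to
    identities in the field, coordinate by coordinate. *)
Record pencil := Pencil {
  idx : Type;
  lvl : int -> pred idx;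
  opF : {linear (idx -> K^o) -> (idx -> K^o)};
  opG : {linear (idx -> K^o) -> (idx -> K^o)};
  opC : forall u, opF (opG u) = opG (opF u);
  opF_lvl : forall e u, supported (lvl e) u -> supported (lvl (e + 2)) (opF u);
  opG_lvl : forall e u, supported (lvl e) u -> supported (lvl (e + 2)) (opG u)
}.

Definition shift (V : zmodType) (a : nat -> V) (i : nat) : V :=
  if i is i'.+1 then a i' else 0.

Section Form.
Variable P : pencil.
Local Notation V := (idx P -> K^o).
Local Notation F := (opF P).
Local Notation G := (opG P).
Implicit Types (a b : nat -> V) (j : nat).

(** The sum of the F^(j-i) G^i (a i) over i <= j. *)
Fixpoint binform j a : V :=
  if j is j'.+1 then F (binform j' a) + iter j G (a j) else a 0.

Lemma iterG_linear i c (u v : V) :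
  iter i G (c *: u + v) = c *: iter i G u + iter i G v.
Proof. by elim: i => //= i ->; rewrite linearP. Qed.

Lemma eq_binform j a b : (forall i, (i <= j)%N -> a i = b i) ->
  binform j a = binform j b.
Proof.
elim: j => [|j IHj] ab /=; first exact: ab.
by rewrite ab // IHj // => i ij; apply: ab; apply: leqW.
Qed.

Lemma binform_lin j c a b :
  binform j (fun i => c *: a i + b i) = c *: binform j a + binform j b.
Proof.
elim: j => //= j ->; rewrite iterG_linear !linearP.
by rewrite scalerDr addrACA.
Qed.

Lemma iterG0 i : iter i G (0 : V) = 0.
Proof. by elim: i => //= i ->; rewrite linear0. Qed.

Lemma iterF0 i : iter i F (0 : V) = 0.
Proof. by elim: i => //= i ->; rewrite linear0. Qed.

Lemma iterGZ i c (u : V) : iter i G (c *: u) = c *: iter i G u.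
Proof. by elim: i => //= i ->; rewrite linearZ. Qed.

Lemma binform0 j : binform j (fun=> 0) = 0.
Proof.
elim: j => //= j ->; rewrite linear0 add0r -[RHS](iterG0 j.+1) //.
Qed.

Lemma binformZ j c a : binform j (fun i => c *: a i) = c *: binform j a.
Proof.
rewrite -[RHS]addr0 -(binform0 j) -binform_lin.
by apply: eq_binform => i _; rewrite addr0.
Qed.

Lemma binformD j a b : binform j (fun i => a i + b i) = binform j a + binform j b.
Proof.
rewrite -[binform j a]scale1r -binform_lin.
by apply: eq_binform => i _; rewrite scale1r.
Qed.

Lemma binformB j a b : binform j (fun i => a i - b i) = binform j a - binform j b.
Proof.
rewrite addrC -scaleN1r -binform_lin.
by apply: eq_binform => i _; rewrite scaleN1r addrC.
Qed.

Lemma iterGF i u : iter i G (F u) = F (iter i G u).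
Proof. by elim: i => //= i ->; rewrite opC. Qed.

Lemma iterGB i u v : iter i G (u - v) = iter i G u - iter i G v.
Proof. by elim: i => //= i ->; rewrite linearB. Qed.

Lemma binform_shift j a : binform j.+1 (shift a) = G (binform j a).
Proof.
elim: j => [|j IHj]; first by rewrite /= linear0 add0r.
by rewrite [LHS]/= -/(binform j.+1 (shift a)) IHj /= linearD opC.
Qed.

Lemma binform_widen j a : a j.+1 = 0 -> binform j.+1 a = F (binform j a).
Proof.
by move=> a0; rewrite /= a0 iterG0 linear0 addr0. Qed.

(** The sum telescopes: the parts of two consecutive terms that involve the same
    [b i] cancel. *)
Lemma binform_trivial j b :
  binform j (fun i => G (b i.+1) - F (b i)) = iter j.+1 G (b j.+1) - iter j.+1 F (b 0).
Proof.
elim: j => //= j ->; rewrite linearB -[G (iter j G _)]/(iter j.+1 G _).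
rewrite iterGB iterGF -!iterSr /= linearB.
by rewrite opC; apply/funext=> x; rewrite !fctE; ring.
Qed.

(** All the relations of degree at most [t] between the generators
    F^(j-i) G^i of the powers of the ideal (F, G), with coefficients in the
    module, follow from G (F^(j-i) G^i) = F (F^(j-i-1) G^(i+1)).  The bound
    weighs a generator of the j-th power with j, although its degree is 2 j. *)
Definition lin_syz (t : int) := forall j (e : int) a, e + j%:Z <= t ->
  (forall i, (i <= j)%N -> supported (lvl e) (a i)) -> binform j a = 0 ->
  exists b, [/\ b 0 = 0, b j.+1 = 0,
    (forall i, supported (lvl (e - 2)) (b i)) &
    forall i, (i <= j)%N -> a i = G (b i.+1) - F (b i)].

End Form.

Section Block.
Variables (I J : Type) (s : J -> option J).

Definition slice (u : I * J -> K^o) (c : J) : I -> K^o := fun x => u (x, c).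

(** The operator on a tensor product that is the sum of the actions on the two
    factors.  The type [J] is a basis of the second factor, and [s c = Some d]
    means that the basis element [d] is mapped to [c]. *)
Definition block_op (F : {linear (I -> K^o) -> (I -> K^o)}) (u : I * J -> K^o) :
    I * J -> K^o :=
  fun xc => F (slice u xc.2) xc.1 + if s xc.2 is Some d then u (xc.1, d) else 0.

Lemma block_op_linear F : linear (block_op F).
Proof.
move=> c u v; apply/funext => -[x d]; rewrite /block_op /=.
have -> : slice (c *: u + v) d = c *: slice u d + slice v d by [].
rewrite linearP !fctE /=; case: (s d) => [d'|].
  by rewrite /GRing.scale /=; ring.
by rewrite /GRing.scale /=; ring.
Qed.
HB.instance Definition _ F :=
  GRing.isLinear.Build K _ _ *:%R (block_op F) (block_op_linear F).

Lemma slice_block_op F u c :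
  slice (block_op F u) c = F (slice u c) + if s c is Some d then slice u d else 0.
Proof. by apply/funext => x; rewrite /slice /block_op /= !fctE; case: (s c). Qed.
End Block.

Section BlockPencil.
Variables (P : pencil) (J : Type) (d : J -> int) (sF sG : J -> option J).
Hypotheses (dF : forall c c', sF c = Some c' -> d c = d c' + 2)
           (dG : forall c c', sG c = Some c' -> d c = d c' + 2)
           (sC : forall c, obind sF (sG c) = obind sG (sF c)).

Definition block_lvl (e : int) : pred (idx P * J) :=
  fun xc => lvl (e - d xc.2) xc.1.

Lemma supported_slice e u : supported (block_lvl e) u <->
  forall c, supported (lvl (e - d c)) (slice u c).
Proof. by split=> [Su c x|Su [x c]]; [apply: (Su (x, c)) | apply: Su]. Qed.

Lemma slice_eq (u v : idx P * J -> K^o) :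
  (forall c, slice u c = slice v c) -> u = v.
Proof. by move=> uv; apply/funext => -[x c]; have /(congr1 (@^~ x)) := uv c. Qed.

Lemma block_opC u :
  block_op sF (opF P) (block_op sG (opG P) u) =
  block_op sG (opG P) (block_op sF (opF P) u).
Proof.
apply: slice_eq => c; rewrite !slice_block_op !linearD !opC /=.
have := sC c; case: (sF c) => [c1|]; case: (sG c) => [c2|] //=;
  rewrite ?linear0 ?addr0 ?slice_block_op //.
- by move=> ->; case: (sG c1) => [c3|]; apply/funext=> x; rewrite !fctE; ring.
- by move=> <-; rewrite addr0.
- by move=> ->; rewrite addr0.
Qed.

Lemma block_op_lvl (F : {linear (idx P -> K^o) -> (idx P -> K^o)}) s :
  (forall e u, supported (lvl e) u -> supported (lvl (e + 2)) (F u)) ->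
  (forall c c', s c = Some c' -> d c = d c' + 2) ->
  forall e u, supported (block_lvl e) u ->
    supported (block_lvl (e + 2)) (block_op s F u).
Proof.
move=> F_lvl ds e u /supported_slice Su; apply/supported_slice => c.
rewrite slice_block_op; apply: supportedD.
  by rewrite addrAC; apply: F_lvl.
case E: (s c) => [c'|]; last exact: supported0.
by rewrite (ds _ _ E) (_ : e + 2 - _ = e - d c'); [exact: Su | ring].
Qed.

Definition block_pencil : pencil :=
  @Pencil _ block_lvl (block_op sF (opF P)) (block_op sG (opG P)) block_opC
    (block_op_lvl (@opF_lvl P) dF) (block_op_lvl (@opG_lvl P) dG).
End BlockPencil.
End Pencil.

Section Steps.
Variable K : numFieldType.
Implicit Type P : pencil K.

Section BlockForm.
Variables (P : pencil K) (J : Type) (d : J -> int) (sF sG : J -> option J).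
Hypotheses (dF : forall c c', sF c = Some c' -> d c = d c' + 2)
           (dG : forall c c', sG c = Some c' -> d c = d c' + 2)
           (sC : forall c, obind sF (sG c) = obind sG (sF c)).
Local Notation BP := (@block_pencil K P J d sF sG dF dG sC).

Lemma slice_iter (s : J -> option J)
    (F : {linear (idx P -> K^o) -> (idx P -> K^o)}) c i u :
  s c = None -> slice (iter i (block_op s F) u) c = iter i F (slice u c).
Proof. by move=> sc; elim: i => //= i <-; rewrite slice_block_op sc addr0. Qed.

Lemma slice_iterS (s : J -> option J)
    (F : {linear (idx P -> K^o) -> (idx P -> K^o)}) c c' i u :
  s c = Some c' -> s c' = None ->
  slice (iter i.+1 (block_op s F) u) c =
  iter i.+1 F (slice u c) + i.+1%:R *: iter i F (slice u c').
Proof.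
move=> sc sc'; elim: i => [|i IHi]; first by rewrite /= slice_block_op sc scale1r.
rewrite iterS slice_block_op sc IHi slice_iter // linearD linearZ /=.
apply/funext => x; rewrite !fctE /GRing.scale /=; ring.
Qed.

Lemma slice_binform c j (a : nat -> idx BP -> K^o) : sF c = None -> sG c = None ->
  slice (binform (P:=BP) j a) c = binform (P:=P) j (fun i => slice (a i) c).
Proof.
move=> Fc Gc; elim: j => //= j <-.
rewrite -[G in _ = _ + G](slice_iter _ j.+1 _ Gc).
rewrite -[X in _ = opF P X + _]/(iter 0 (opF P) _) -[in RHS]iterS.
by rewrite -(slice_iter _ 1 _ Fc).
Qed.

(** Since the action on the small module squares to zero, expanding (F + s)^(j-i)
    leaves only the two terms F^(j-i) and (j-i) s F^(j-i-1). *)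
Lemma slice_binformF c c' j (a : nat -> idx BP -> K^o) :
  sF c = Some c' -> sG c = None -> sF c' = None -> sG c' = None ->
  slice (binform (P:=BP) j.+1 a) c = binform (P:=P) j.+1 (fun i => slice (a i) c)
    + binform (P:=P) j (fun i => (j.+1 - i)%:R *: slice (a i) c').
Proof.
move=> Fc Gc Fc' Gc'.
have step i : slice (binform (P:=BP) i.+1 a) c =
    opF P (slice (binform (P:=BP) i a) c) + slice (binform (P:=BP) i a) c' +
    iter i.+1 (opG P) (slice (a i.+1) c).
  rewrite -(slice_iter _ _ _ Gc) /=.
  rewrite -[X in X + _ = _](_ :
    slice (block_op sF (opF P) (binform (P:=BP) i a)) c = _) //.
  by rewrite slice_block_op Fc.
elim: j => [|j IHj]; rewrite step.
  by rewrite /= scale1r addrAC.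
rewrite IHj slice_binform // linearD.
have -> : binform j.+1 (fun i => (j.+2 - i)%:R *: slice (a i) c') =
    opF P (binform j (fun i => (j.+1 - i)%:R *: slice (a i) c')) +
    binform j.+1 (fun i => slice (a i) c').
  rewrite -binform_widen ?subnn ?scale0r // -binformD.
  by apply: eq_binform => i ij; rewrite subSn // -natr1 scalerDl scale1r.
set X := binform j _; set Y := binform j.+1 _; set Z := binform j.+1 _.
rewrite -[binform j.+2 _]/(opF P Y + _).
by apply/funext => x; rewrite !fctE; ring.
Qed.

Lemma slice_binformG c c' j (a : nat -> idx BP -> K^o) :
  sF c = None -> sG c = Some c' -> sF c' = None -> sG c' = None ->
  slice (binform (P:=BP) j.+1 a) c = binform (P:=P) j.+1 (fun i => slice (a i) c)
    + binform (P:=P) j (fun i => i.+1%:R *: slice (a i.+1) c').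
Proof.
move=> Fc Gc Fc' Gc'.
have step i : slice (binform (P:=BP) i.+1 a) c =
    opF P (slice (binform (P:=BP) i a) c) +
    (iter i.+1 (opG P) (slice (a i.+1) c) +
     i.+1%:R *: iter i (opG P) (slice (a i.+1) c')).
  rewrite -(slice_iterS _ _ _ Gc) //=.
  rewrite -[X in X + _ = _](_ :
    slice (block_op sF (opF P) (binform (P:=BP) i a)) c = _) //.
  by rewrite slice_block_op Fc addr0.
elim: j => [|j IHj]; rewrite step.
  by rewrite /= addrA.
rewrite IHj linearD.
set X := binform j _; set Y := binform j.+1 _.
rewrite -[binform j.+2 _]/(opF P Y + _) -[binform j.+1 _]/(opF P X + _).
cbv beta; rewrite iterGZ.
by apply/funext => x; rewrite !fctE; ring.
Qed.
End BlockForm.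
End Steps.

Section GenStep.
Variables (K : numFieldType) (P : pencil K).
Local Notation F := (opF P).
Local Notation G := (opG P).

Definition unslice (I J : Type) (w : J -> I -> K^o) : I * J -> K^o :=
  fun xc => w xc.2 xc.1.

(** The module spanned by 1, xy, yz, indexed by [None], [Some true] and
    [Some false]: F maps 1 to xy and G maps 1 to yz. *)
Definition gen_dx (c : option bool) : int := if c is Some _ then 2 else 0.
Definition gen_F (c : option bool) :=
  if c is Some true then Some (@None bool) else None.
Definition gen_G (c : option bool) :=
  if c is Some false then Some (@None bool) else None.

Lemma gen_dF c c' : gen_F c = Some c' -> gen_dx c = gen_dx c' + 2.
Proof. by case: c => [[]|] // [<-]. Qed.
Lemma gen_dG c c' : gen_G c = Some c' -> gen_dx c = gen_dx c' + 2.
Proof. by case: c => [[]|] // [<-]. Qed.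
Lemma gen_C c : obind gen_F (gen_G c) = obind gen_G (gen_F c).
Proof. by case: c => [[]|]. Qed.

Definition gen_pencil : pencil K := @block_pencil K P _ _ _ _ gen_dF gen_dG gen_C.

(** The two vanishing sums are the derivatives, with respect to F and to G, of
    the sum of the F^(j+1-i) G^i (v i).  Each is a relation for the j-th power,
    hence trivial, and gives (j+1-i) v_i and i v_i in the form G b' - F b.
    Comparing the two gives relations for (F, G) itself, which are again
    trivial, and solving the resulting linear equations shows that [v] is
    trivial in a stronger sense: the coefficients [m] in v_i = G m_(i+1) - F m_i
    are themselves of the form m_i = G w_i - F w_(i-1).  This uses
    characteristic zero. *)
Lemma reduced_syz (t : int) j (e : int) (v : nat -> idx P -> K^o) :
  lin_syz P t -> e + j%:Z <= t ->
  (forall i, (i <= j.+1)%N -> supported (lvl e) (v i)) ->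
  binform (P:=P) j (fun i => (j.+1 - i)%:R *: v i) = 0 ->
  binform (P:=P) j (fun i => i.+1%:R *: v i.+1) = 0 ->
  exists w : nat -> idx P -> K^o,
    [/\ w 0 = 0, (forall i, (j < i)%N -> w i = 0),
      (forall i, supported (lvl (e - 4)) (w i)) &
      forall i, (i <= j.+1)%N ->
        v i = G (G (w i.+1)) - 2 *: F (G (w i)) + F (F (shift w i))].
Proof.
move=> Pt ejt Sv vF vG.
have S1 i : (i <= j)%N -> supported (lvl e) ((j.+1 - i)%:R *: v i).
  by move=> ij; apply/supportedZ/Sv/leqW.
have S2 i : (i <= j)%N -> supported (lvl e) (i.+1%:R *: v i.+1).
  by move=> ij; apply/supportedZ/Sv.
have [b [b0 bj Sb vb]] := Pt _ _ _ ejt S1 vF.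
have [c [c0 cj Sc vc]] := Pt _ _ _ ejt S2 vG.
(* For 0 < i <= j both formulas apply to [v i]; multiplying each by the factor
   of the other and subtracting leaves a relation between F and G. *)
have mid i : exists u : idx P -> K^o, (0 < i <= j)%N ->
    [/\ supported (lvl (e - 4)) u, i%:R *: b i - (j.+1 - i)%:R *: shift c i = G u &
        i%:R *: b i.+1 - (j.+1 - i)%:R *: c i = F u].
  case: (boolP (0 < i <= j)%N) => [/andP[]|_]; last by exists 0.
  case: i => // i _ ij.
  pose a k : idx P -> K^o := if k is 0 then i.+1%:R *: b i.+1 - (j - i)%:R *: c i
    else (j - i)%:R *: c i.+1 - i.+1%:R *: b i.+2.
  have ajt : e - 2 + 1%:Z <= t by lia.
  have Sa k : (k <= 1)%N -> supported (lvl (e - 2)) (a k).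
    by case: k => [|k] _; apply: supportedB; apply: supportedZ.
  have a0 : binform (P:=P) 1 a = 0.
    rewrite /= !linearB /= !linearZ /=.
    have /(congr1 (fun u => i.+1%:R *: u)) := vb _ ij.
    have /(congr1 (fun u => (j - i)%:R *: u)) := vc _ (ltnW ij).
    rewrite subSS scalerA mulrC -scalerA => -> E.
    have {E} : (j - i)%:R *: (G (c i.+1) - F (c i)) =
      i.+1%:R *: (G (b i.+2) - F (b i.+1)) by [].
    move=> E; apply/funext => x; have := congr1 (@^~ x) E.
    rewrite !fctE /GRing.scale /= => E'.
    by transitivity ((j - i)%:R * (G (c i.+1) x - F (c i) x)
      - i.+1%:R * (G (b i.+2) x - F (b i.+1) x)); [ring | rewrite E' subrr].
  have [u [u0 u2 Su au]] := Pt _ _ _ ajt Sa a0.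
  exists (u 1) => _; rewrite subSS; split.
  - by rewrite (_ : e - 4 = e - 2 - 2); [exact: Su | ring].
  - by have := au 0 isT; rewrite u0 linear0 subr0.
  - have := au 1 isT; rewrite u2 linear0 sub0r /= => E.
    by rewrite -[RHS]opprK -E opprB.
have [u Hu] := choice mid.
pose w i : idx P -> K^o := if (0 < i <= j)%N then j.+1%:R^-1 *: u i else 0.
have J0 : j.+1%:R != 0 :> K by rewrite pnatr_eq0.
have w0 i : (0 < i <= j)%N = false -> w i = 0 by rewrite /w => ->.
have Sw i : supported (lvl (e - 4)) (w i).
  rewrite /w; case: ifP => [/Hu[Su _ _]|_]; first exact: supportedZ.
  exact: supported0.
have uE i : (0 < i <= j)%N -> u i = j.+1%:R *: w i.
  by rewrite /w => ->; rewrite scalerA mulfV ?scale1r.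
have eqB i : (i <= j)%N ->
    i.+1%:R *: b i.+1 - (j - i)%:R *: c i = j.+1%:R *: G (w i.+1).
  move=> ij; case: (ltngtP i j) ij => // [ij _|-> _]; last first.
    by rewrite bj subnn scaler0 scale0r subr0 w0 ?ltnn // linear0 scaler0.
  by rewrite -linearZ -uE //; have [_ /= <- _] := Hu i.+1 ij; rewrite subSS.
have eqA i : (i <= j)%N ->
    i%:R *: b i.+1 - (j.+1 - i)%:R *: c i = j.+1%:R *: F (w i).
  case: i => [|i] ij; first by rewrite c0 w0 // !linear0 scale0r addr0.
  by rewrite -linearZ -uE //; have [_ _ /= <-] := Hu i.+1 ij.
have natJ i : (i <= j)%N -> (j.+1 - i)%:R = j%:R + 1 - i%:R :> K.
  by move=> ij; rewrite natrB ?leqW // -natr1.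
(* [eqA] and [eqB] are two linear equations for [b i.+1] and [c i], with
   determinant j + 1. *)
have bE i : (i <= j.+1)%N ->
    b i = (j.+1 - i).+1%:R *: (G (w i) - F (shift w i)) + F (shift w i).
  case: i => [_|i ij]; first by rewrite b0 w0 //= !linear0 !addr0 scaler0.
  have := eqB i ij; have := eqA i ij => /= EA EB.
  apply/funext => x; apply: (mulfI J0).
  have := congr1 (@^~ x) EA; have := congr1 (@^~ x) EB.
  rewrite !fctE /GRing.scale /= subSS -!natr1 natJ // natrB // => EB' EA'.
  transitivity ((j%:R + 1 - i%:R) * ((i%:R + 1) * b i.+1 x - (j%:R - i%:R) * c i x)
    - (j%:R - i%:R) * (i%:R * b i.+1 x - (j%:R + 1 - i%:R) * c i x)).
    by ring.
  by rewrite EA' EB'; ring.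
have cE i : (i <= j)%N ->
    c i = i%:R *: (G (w i.+1) - F (w i)) - F (w i).
  move=> ij; have := eqB i ij; have := eqA i ij => /= EA EB.
  apply/funext => x; apply: (mulfI J0).
  have := congr1 (@^~ x) EA; have := congr1 (@^~ x) EB.
  rewrite !fctE /GRing.scale /= natJ // natrB // -!natr1 => EB' EA'.
  transitivity (i%:R * ((i%:R + 1) * b i.+1 x - (j%:R - i%:R) * c i x)
    - (i%:R + 1) * (i%:R * b i.+1 x - (j%:R + 1 - i%:R) * c i x)).
    by ring.
  by rewrite EA' EB'; ring.
have wbig i : (j < i)%N -> w i = 0.
  by move=> ji; apply: w0; rewrite [(i <= j)%N]leqNgt ji andbF.
exists w; split=> // i ij.
case: (ltngtP i j.+1) ij => // [ij _|-> _]; last first.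
  have := vc j (leqnn j); rewrite cj cE // (wbig j.+1) // (wbig j.+2) // !linear0 => E.
  apply/funext => x; apply: (mulfI J0); have := congr1 (@^~ x) E.
  have z0 : (0 : idx P -> K^o) x = 0 by [].
  rewrite /= !(linearB, linearZ) /= !linear0 !fctE /GRing.scale /= z0 -natr1 => ->.
  ring.
have Ji0 : (j.+1 - i)%:R != 0 :> K by rewrite pnatr_eq0 subn_eq0 -ltnNge.
have := vb i ij; rewrite (bE i.+1) // (bE i) 1?ltnW // ?subSS.
rewrite !(linearD, linearN, linearZ) /= !opC => E.
apply/funext => x; apply: (mulfI Ji0); have := congr1 (@^~ x) E.
by rewrite !fctE /GRing.scale /= -!natr1 natJ // natrB // => ->; ring.
Qed.

End GenStep.

Section Steps.
Variables (K : numFieldType) (P : pencil K).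
Local Notation F := (opF P).
Local Notation G := (opG P).
Local Notation M := (gen_pencil P).
Implicit Types (i j : nat) (e t : int).

(** Write a_i = n_i + xy p_i + yz q_i.  Applying F to the coordinate xy and G to
    the coordinate yz of the given relation, and using the coordinate 1 to
    eliminate n (Euler's identity), leaves a relation of the next higher power
    between the p_i + q_(i-1).  Subtracting the trivial syzygies that this
    provides makes p and q vanish, and then [reduced_syz] applies to n. *)
Lemma lin_syz_gen t : lin_syz P t -> lin_syz M (t + 1).
Proof.
move=> Pt [|j] e a ejt Sa a0.
  exists (fun=> 0); split=> // [i|i]; first exact: supported0.
  by rewrite leqn0 => /eqP->; rewrite -[LHS]/(binform (P:=M) 0 a) a0 !linear0 addr0.
pose n i := slice (a i) None; pose p i := slice (a i) (Some true).
pose q i : idx P -> K^o := if (i <= j.+1)%N then slice (a i) (Some false) else 0.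
have Sn i : (i <= j.+1)%N -> supported (lvl e) (n i).
  by move=> /Sa/supported_slice/(_ None); rewrite subr0.
have Sp i : (i <= j.+1)%N -> supported (lvl (e - 2)) (p i).
  by move=> /Sa/supported_slice/(_ (Some true)).
have Sq i : supported (lvl (e - 2)) (q i).
  rewrite /q; case: ifP => [|_]; last exact: supported0.
  by move=> /Sa/supported_slice/(_ (Some false)).
have eqn : binform (P:=P) j.+1 n = 0.
  by rewrite -(slice_binform j.+1 a (c := None)) // a0.
have eqp : binform (P:=P) j.+1 p +
    binform (P:=P) j (fun i => (j.+1 - i)%:R *: n i) = 0.
  by rewrite -(slice_binformF j a (c := Some true)) // a0.
have eqq : binform (P:=P) j.+1 q +
    binform (P:=P) j (fun i => i.+1%:R *: n i.+1) = 0.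
  rewrite (eq_binform (b := fun i => slice (a i) (Some false))).
    by rewrite -(slice_binformG j a (c := Some false)) // a0.
  by rewrite /q => i ->.
pose w i : idx P -> K^o := (if (i <= j.+1)%N then p i else 0) + shift q i.
(* Euler's identity: F d/dF + G d/dG multiplies the form of [n] by j + 1. *)
have w0 : binform (P:=P) j.+2 w = 0.
  rewrite binformD binform_shift binform_widen ?ltnn //.
  rewrite (eq_binform (b := p)) => [|i ->] //.
  have /(congr1 F) := eqp; have /(congr1 G) := eqq; rewrite !linearD !linear0.
  rewrite -binform_shift -[F (binform j _)]binform_widen ?subnn ?scale0r //.
  move=> eqG eqF.
  have : binform (P:=P) j.+1 (shift (fun i => i.+1%:R *: n i.+1)) +
         binform (P:=P) j.+1 (fun i => (j.+1 - i)%:R *: n i) = 0.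
    rewrite -binformD -[RHS](scaler0 _ j.+1%:R) -eqn -binformZ.
    apply: eq_binform => -[|i] ij /=; first by rewrite add0r subn0.
    by rewrite -scalerDl -natrD subnKC.
  move: eqF eqG => /eqP; rewrite addr_eq0 => /eqP-> /eqP.
  by rewrite addr_eq0 => /eqP-> E; rewrite -opprD addrC E oppr0.
have ejt2 : e - 2 + j.+2%:Z <= t by lia.
have Sw i : (i <= j.+2)%N -> supported (lvl (e - 2)) (w i).
  move=> ij; apply: supportedD.
    by case: ifP => [/Sp|_] //; apply: supported0.
  by case: i ij => [|i] _; [apply: supported0 | apply: Sq].
have [b [b0 bj Sb wb]] := Pt _ _ _ ejt2 Sw w0.
have {}Sb i : supported (lvl (e - 4)) (b i).
  by rewrite (_ : e - 4 = e - 2 - 2); [exact: Sb | ring].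
(* For every [tau], the trivial syzygy given by [be tau] has the coordinates [p]
   and [q]; the only constraints on [tau] are that [be tau] vanish at 0 and at
   [j.+2]. *)
pose m tau i := shift q i - G (tau i) + F (shift tau i).
pose be tau i : idx M -> K^o := unslice (fun c =>
  if c is Some d then (if d then b i - shift tau i else tau i) else m tau i).
have be_slice (tau : nat -> idx P -> K^o) i c : (i <= j.+1)%N ->
    slice (a i - (opG M (be tau i.+1) - opF M (be tau i))) c =
    if c is Some _ then 0 else n i - (G (m tau i.+1) - F (m tau i)).
  move=> ij.
  have -> : slice (a i - (opG M (be tau i.+1) - opF M (be tau i))) c =
    slice (a i) c - (slice (opG M (be tau i.+1)) c - slice (opF M (be tau i)) c).
    by [].
  have sN k : slice (be tau k) None = m tau k by [].
  have sT k : slice (be tau k) (Some true) = b k - shift tau k by [].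
  have sF k : slice (be tau k) (Some false) = tau k by [].
  rewrite !slice_block_op; case: c => [[]|] /=.
  - rewrite sN !sT addr0 /m -/(p i); have := wb i (leqW ij); rewrite /w ij => E.
    have {E} -> : p i = G (b i.+1) - F (b i) - shift q i by rewrite -E addrK.
    rewrite !linearB /=; apply/funext => x; rewrite !fctE.
    by rewrite -[RHS]/(0 : K); ring.
  - rewrite sN !sF addr0 /m /= (_ : slice (a i) _ = q i) ?/q ?ij //.
    apply/funext => x; rewrite !fctE.
    by rewrite -[RHS]/(0 : K); ring.
  - by rewrite !sN !addr0.
have be0 tau : tau 0 = 0 -> be tau 0 = 0.
  move=> tau0; apply: slice_eq => -[[]|]; rewrite /slice /be /unslice /=.
  - by rewrite b0 subrr.
  - exact: tau0.
  - by rewrite /m tau0 /= !linear0 !addr0.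
have bej tau : tau j.+1 = b j.+2 -> tau j.+2 = 0 -> be tau j.+2 = 0.
  move=> tauj tauj2; apply: slice_eq => -[[]|]; rewrite /slice /be /unslice /=.
  - by rewrite tauj subrr.
  - exact: tauj2.
  - rewrite -[LHS]/(m tau j.+2) /m /= tauj tauj2 linear0 subr0.
    have := wb j.+2 (leqnn _); rewrite /w ltnn bj linear0 !add0r /= => ->.
    by rewrite addNr.
have Sbe tau : (forall i, supported (lvl (e - 4)) (tau i)) ->
    forall i, supported (lvl (e - 2)) (be tau i).
  move=> Stau i; have Ssh : supported (lvl (e - 4)) (shift tau i).
    by case: i => [|i]; [apply: supported0 | apply: Stau].
  have e4 : e - 4 + 2 = e - 2 by ring.
  apply/supported_slice => -[[]|]; rewrite /slice /be /unslice /=.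
  - by rewrite (_ : e - 2 - 2 = e - 4); [apply: supportedB | ring].
  - by rewrite (_ : e - 2 - 2 = e - 4); [apply: Stau | ring].
  - rewrite subr0; apply: supportedD; last by rewrite -e4; apply: opF_lvl.
    apply: supportedB; last by rewrite -e4; apply: opG_lvl.
    by case: i {Ssh} => [|i]; [apply: supported0 | apply: Sq].
pose tau0 i : idx P -> K^o := if i == j.+1 then b j.+2 else 0.
have tau0j : tau0 j.+1 = b j.+2 by rewrite /tau0 eqxx.
have tau0j2 : tau0 j.+2 = 0 by rewrite /tau0 eqn_leq ltnn.
pose v i := n i - (G (m tau0 i.+1) - F (m tau0 i)).
pose a' i := a i - (opG M (be tau0 i.+1) - opF M (be tau0 i)).
have a'0 : binform (P:=M) j.+1 a' = 0.
  by rewrite binformB binform_trivial bej // be0 // a0 iterG0 iterF0 !subr0.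
have a'N i : (i <= j.+1)%N -> slice (a' i) None = v i by move=> ij; apply: be_slice.
have ejt0 : e + j%:Z <= t by lia.
have Stau0 i : supported (lvl (e - 4)) (tau0 i).
  by rewrite /tau0; case: eqP => _; [apply: Sb | apply: supported0].
have Sv i : (i <= j.+1)%N -> supported (lvl e) (v i).
  move=> ij; rewrite -a'N // -[e]subr0; have e2 : e - 2 + 2 = e by ring.
  have Sa' : supported (lvl e) (a' i).
    apply: supportedB; first exact: Sa.
    by apply: supportedB; rewrite -e2; [apply: opG_lvl | apply: opF_lvl]; apply: Sbe.
  by have /supported_slice/(_ None) := Sa'.
have a'S i d : (i <= j.+1)%N -> slice (a' i) (Some d) = 0.
  by move=> ij; apply: be_slice.
have vF : binform (P:=P) j (fun i => (j.+1 - i)%:R *: v i) = 0.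
  have := slice_binformF j a' (c := Some true) erefl erefl erefl erefl.
  rewrite a'0 (eq_binform (a := fun i => slice (a' i) _) (b := fun=> 0)); last first.
    by move=> i ij; apply: a'S.
  rewrite binform0 add0r => E.
  transitivity (slice (0 : idx M -> K^o) (Some true)) => //.
  by rewrite E; apply: eq_binform => i ij; rewrite a'N // leqW.
have vG : binform (P:=P) j (fun i => i.+1%:R *: v i.+1) = 0.
  have := slice_binformG j a' (c := Some false) erefl erefl erefl erefl.
  rewrite a'0 (eq_binform (a := fun i => slice (a' i) _) (b := fun=> 0)); last first.
    by move=> i ij; apply: a'S.
  rewrite binform0 add0r => E.
  transitivity (slice (0 : idx M -> K^o) (Some false)) => //.
  by rewrite E; apply: eq_binform => i ij; rewrite a'N.
have [u [u0 uj Su uv]] := reduced_syz Pt ejt0 Sv vF vG.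
(* Changing [tau0] by [u] changes the coordinate 1 by the second difference that
   [reduced_syz] provides, and keeps the other two. *)
pose tau i := tau0 i - u i.
exists (fun i => be tau i); split.
- by apply: be0; rewrite /tau u0 subr0.
- by apply: bej; rewrite /tau uj // subr0.
- by apply: Sbe => i; apply: supportedB.
move=> i ij; apply/eqP; rewrite -subr_eq0; apply/eqP.
apply: slice_eq => c; rewrite be_slice //; case: c => // .
have -> : n i = v i + (G (m tau0 i.+1) - F (m tau0 i)) by rewrite subrK.
have shB : shift tau i = shift tau0 i - shift u i.
  by case: i {ij} => //=; rewrite subr0.
pose FGE := (linearD F, linearN F, linearD G, linearN G).
rewrite uv // /m shB /tau !FGE /= !opC.
apply/funext => x; rewrite !fctE /GRing.scale /=.
by rewrite -[RHS]/(0 : K); ring.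
Qed.

(** The module spanned by z, x, xyz, indexed by [Some true], [Some false] and
    [None]: F maps z to xyz and G maps x to xyz.  Degrees are counted from that
    of x and z. *)
Definition cog_dx (c : option bool) : int := if c is Some _ then 0 else 2.
Definition cog_F (c : option bool) := if c is None then Some (Some true) else None.
Definition cog_G (c : option bool) := if c is None then Some (Some false) else None.

Lemma cog_dF c c' : cog_F c = Some c' -> cog_dx c = cog_dx c' + 2.
Proof. by case: c => [[]|] // [<-]. Qed.
Lemma cog_dG c c' : cog_G c = Some c' -> cog_dx c = cog_dx c' + 2.
Proof. by case: c => [[]|] // [<-]. Qed.
Lemma cog_C c : obind cog_F (cog_G c) = obind cog_G (cog_F c).
Proof. by case: c => [[]|]. Qed.

Definition cog_pencil : pencil K := block_pencil P cog_dF cog_dG cog_C.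
Local Notation M' := cog_pencil.

(** Both the submodule spanned by xyz and the quotient by it have trivial action,
    so the relations of the quotient are lifted first, and what remains is a
    relation in the submodule. *)
Lemma lin_syz_cog t : lin_syz P t -> lin_syz M' t.
Proof.
move=> Pt j e a ejt Sa a0.
have side d : exists b, [/\ b 0 = 0, b j.+1 = 0,
    (forall i, supported (lvl (e - 2)) (b i)) &
    forall i, (i <= j)%N -> slice (a i) (Some d) = G (b i.+1) - F (b i)].
  apply: Pt ejt _ _ => [i ij|].
    by have /supported_slice/(_ (Some d)) := Sa i ij; rewrite /= subr0.
  by rewrite -(slice_binform (c := Some d)) // a0.
have [b [b0 bj Sb ab]] := side true; have [c [c0 cj Sc ac]] := side false.
pose be i : idx M' -> K^o := unslice (fun x =>
  if x is Some d then (if d then b i else c i) else 0).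
have be_slice i d : (i <= j)%N ->
    slice (a i - (opG M' (be i.+1) - opF M' (be i))) d =
    if d is Some _ then 0 else slice (a i) None - (c i.+1 - b i).
  move=> ij.
  have -> : slice (a i - (opG M' (be i.+1) - opF M' (be i))) d =
    slice (a i) d - (slice (opG M' (be i.+1)) d - slice (opF M' (be i)) d).
    by [].
  have sN k : slice (be k) None = 0 by [].
  have sT k : slice (be k) (Some true) = b k by [].
  have sF k : slice (be k) (Some false) = c k by [].
  rewrite !slice_block_op; case: d => [[]|] /=.
  - by rewrite !sT !addr0 ab // subrr.
  - by rewrite !sF !addr0 ac // subrr.
  - by rewrite !sN sT sF !linear0 !add0r.
have be0 : be 0 = 0 by apply: slice_eq => -[[]|].
have bej : be j.+1 = 0 by apply: slice_eq => -[[]|].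
have Sbe i : supported (lvl (e - 2)) (be i).
  apply/supported_slice => -[[]|]; rewrite /slice /be /unslice /= ?subr0 //.
  exact: supported0.
pose a' i := a i - (opG M' (be i.+1) - opF M' (be i)).
have a'0 : binform (P:=M') j a' = 0.
  by rewrite binformB binform_trivial bej // be0 // a0 iterG0 iterF0 !subr0.
pose emb (v : idx P -> K^o) : idx M' -> K^o :=
  unslice (fun x => if x is Some _ then 0 else v).
have embF v : opF M' (emb v) = emb (F v).
  by apply: slice_eq => d; rewrite slice_block_op; case: d => [d|] /=;
    rewrite ?addr0 // -[slice _ _]/(0 : idx P -> K^o) linear0.
have embG v : opG M' (emb v) = emb (G v).
  by apply: slice_eq => d; rewrite slice_block_op; case: d => [d|] /=;
    rewrite ?addr0 // -[slice _ _]/(0 : idx P -> K^o) linear0.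
pose v i := slice (a' i) None.
have v0 : binform (P:=P) j v = 0.
  suff E : binform (P:=M') j (fun i => emb (v i)) = emb (binform (P:=P) j v).
    rewrite -[LHS]/(slice (emb (binform (P:=P) j v)) None) -E.
    rewrite (eq_binform (b := a')) ?a'0 // => i ij.
    by apply: slice_eq => -[d|] //; rewrite be_slice.
  elim: j {ejt Sa a0 bj ab cj ac be_slice bej side a'0} => //= j ->.
  have -> k : iter k (opG M') (emb (v j.+1)) = emb (iter k G (v j.+1)).
    by elim: k => //= k ->; rewrite embG.
  rewrite embF embG; apply: slice_eq => -[d|] //.
  by apply/funext => x; rewrite -[LHS]/(0 + 0 : K) addr0.
have Sv i : (i <= j)%N -> supported (lvl (e - 2)) (v i).
  move=> ij; have e2 : e - 2 + 2 = e by ring.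
  have Sa' : supported (lvl e) (a' i).
    apply: supportedB; first exact: Sa.
    by apply: supportedB; rewrite -e2; [apply: opG_lvl | apply: opF_lvl]; apply: Sbe.
  by have /supported_slice/(_ None) := Sa'.
have ejt2 : e - 2 + j%:Z <= t by lia.
have [u [u0 uj Su uv]] := Pt _ _ _ ejt2 Sv v0.
exists (fun i => be i + emb (u i)); split.
- by rewrite be0 u0 add0r; apply: slice_eq => -[d|].
- by rewrite bej uj add0r; apply: slice_eq => -[d|].
- move=> i; apply: supportedD => //; apply/supported_slice => -[d|].
    exact: supported0.
  exact: Su.
move=> i ij; apply/eqP; rewrite -subr_eq0; apply/eqP.
rewrite (linearD (opF M')) (linearD (opG M')) embF embG.
have -> : a i = emb (v i) + (opG M' (be i.+1) - opF M' (be i)).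
  have a'E : a' i = emb (v i).
    by apply: slice_eq => -[d|] //; rewrite be_slice.
  by rewrite -a'E subrK.
have -> : emb (v i) = emb (G (u i.+1)) - emb (F (u i)).
  rewrite uv //; apply: slice_eq => -[d|] //.
  by apply/funext => x; rewrite -[RHS]/(0 - 0 : K) subr0.
by apply/funext => x; rewrite !fctE; rewrite -[RHS]/(0 : K); ring.
Qed.
End Steps.

(** * Sums of products of adjacent variables *)

Section Bits.
Implicit Types (l : seq bool) (k : nat).

(** A list of bits is a set of variables; the product of the variables k and k + 1
    divides the monomial [l] when [has2 l k], with quotient [erase2 l k]. *)
Definition has2 l k := nth false l k && nth false l k.+1.

Fixpoint erase2 l k {struct l} : seq bool :=
  if l is x :: l' then
    if k is k'.+1 then x :: erase2 l' k'
    else if l' is _ :: l'' then [:: false, false & l''] else [:: false]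
  else [::].

Lemma size_erase2 l k : size (erase2 l k) = size l.
Proof.
elim: l k => [|x l IHl] [|k] //=; last by rewrite IHl.
by case: l {IHl}.
Qed.

Lemma nth_erase2 l k m :
  nth false (erase2 l k) m = [&& nth false l m, m != k & m != k.+1].
Proof.
elim: l k m => [|x l IHl] k m; first by rewrite !nth_nil.
case: k => [|k].
  case: l {IHl} => [|y l]; case: m => [|[|m]] //=; rewrite ?andbF ?nth_nil //.
  by rewrite andbT.
by case: m => [|m] /=; rewrite ?andbT ?eqSS.
Qed.

Lemma has2_erase2C l k m :
  has2 l k && has2 (erase2 l k) m = has2 l m && has2 (erase2 l m) k.
Proof.
rewrite /has2 !nth_erase2 !eqSS ![k == _]eq_sym ![k.+1 == _]eq_sym.
case: (nth false l k) (nth false l k.+1) (nth false l m) (nth false l m.+1)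
  => [] [] [] [] //=; rewrite ?andbF ?andbT //.
by do !case: (_ == _).
Qed.

Lemma erase2C l k m : erase2 (erase2 l k) m = erase2 (erase2 l m) k.
Proof.
apply: (@eq_from_nth _ false) => [|i _]; first by rewrite !size_erase2.
by rewrite !nth_erase2 -!andbA; do !bool_congr; rewrite andbC -andbA; do !bool_congr.
Qed.

Lemma count_erase2 l k : has2 l k -> count id l = (count id (erase2 l k)).+2.
Proof.
rewrite /has2; elim: l k => [|x l IHl] [|k] //=.
  case: l {IHl} => [|y l] /=; first by rewrite andbF.
  by case: x; case: y.
by move=> /IHl ->; rewrite !addnS.
Qed.

Variable K : numFieldType.

(** Multiplication by the sum of the products x_k x_(k+1) over [k] in [ks], on
    coefficient functions and without signs. *)
Definition pair_op (ks : seq nat) (u : seq bool -> K^o) : seq bool -> K^o :=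
  fun l => \sum_(k <- ks) if has2 l k then u (erase2 l k) else 0.

Lemma pair_op_linear ks : linear (pair_op ks).
Proof.
move=> c u v; apply/funext => l; rewrite !fctE /pair_op.
rewrite scaler_sumr -big_split /=; apply: eq_bigr => k _.
by case: ifP => _; rewrite ?fctE // scaler0 addr0.
Qed.
HB.instance Definition _ ks :=
  GRing.isLinear.Build K _ _ *:%R (pair_op ks) (pair_op_linear ks).

Lemma pair_opC ks ms u : pair_op ks (pair_op ms u) = pair_op ms (pair_op ks u).
Proof.
apply/funext => l; rewrite /pair_op.
have E ks' ms' : \sum_(k <- ks') (if has2 l k then
    \sum_(m <- ms') (if has2 (erase2 l k) m then u (erase2 (erase2 l k) m) else 0)
    else 0) = \sum_(k <- ks') \sum_(m <- ms')
    if has2 l k && has2 (erase2 l k) m then u (erase2 (erase2 l k) m) else 0.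
  by apply: eq_bigr => k _; case: (has2 l k) => //=; rewrite big1.
rewrite !E exchange_big; apply: eq_bigr => k _; apply: eq_bigr => m _ /=.
by rewrite has2_erase2C erase2C.
Qed.

Definition bits_lvl (n : nat) (e : int) : pred (seq bool) :=
  fun l => (size l == n) && ((count id l)%:Z == e).

Lemma pair_op_lvl n ks e u :
  supported (bits_lvl n e) u -> supported (bits_lvl n (e + 2)) (pair_op ks u).
Proof.
move=> Su l; apply: contraNT => nl; rewrite /pair_op big1_seq // => k _.
case: ifP => // lk; apply/eqP; apply: contraNT nl => /Su /andP[sl cl].
rewrite /bits_lvl -(size_erase2 l k) sl (count_erase2 lk) -(eqP cl).
by apply/eqP; lia.
Qed.

Definition bits_pencil n ks ms : pencil K :=
  @Pencil K _ (bits_lvl n) (pair_op ks) (pair_op ms) (pair_opC ks ms)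
    (@pair_op_lvl n ks) (@pair_op_lvl n ms).

Definition first_pairs t := [seq (i * 3)%N | i <- iota 0 t].
Definition second_pairs t := [seq (i * 3).+1%N | i <- iota 0 t].

Lemma first_pairsS t : first_pairs t.+1 = 0%N :: map (addn 3) (first_pairs t).
Proof. by rewrite /first_pairs /= (iotaDl 1 0) -!map_comp. Qed.
Lemma second_pairsS t : second_pairs t.+1 = 1%N :: map (addn 3) (second_pairs t).
Proof. by rewrite /second_pairs /= (iotaDl 1 0) -!map_comp. Qed.

Definition head3 (x y z : bool) (u : seq bool -> K^o) : seq bool -> K^o :=
  fun l => u [:: x, y, z & l].

Lemma pair_op_head3 k ks u x y z :
  head3 x y z (pair_op (k :: map (addn 3) ks) u) =
  (fun l => if has2 [:: x, y, z & l] k then u (erase2 [:: x, y, z & l] k) else 0)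
  + pair_op ks (head3 x y z u).
Proof.
by apply/funext => l; rewrite /head3 /pair_op big_cons big_map.
Qed.
End Bits.

Section BitsSyz.
Variable K : numFieldType.
Local Notation bits t n := (bits_pencil K n (first_pairs t) (second_pairs t)).

Lemma binform_morph (P Q : pencil K) (f : (idx P -> K^o) -> (idx Q -> K^o)) :
  (forall u v, f (u + v) = f u + f v) ->
  (forall u, f (opF P u) = opF Q (f u)) ->
  (forall u, f (opG P u) = opG Q (f u)) ->
  forall j (a : nat -> idx P -> K^o),
    f (binform j a) = binform j (fun i => f (a i)).
Proof.
move=> fD fF fG.
have fi k v : f (iter k (opG P) v) = iter k (opG Q) (f v).
  by elim: k => //= k <-; rewrite fG.
by elim=> // j IHj a; rewrite [binform _ a]/= fD fF IHj -iterS fi.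
Qed.

(** The first three bits form a block.  [toM] and [toM'] extract the two
    three-dimensional summands of its exterior algebra, and the bits 010 and 101
    are the two lines.  The second summand and the line y start in degree 1, so
    for them the bound for one block less is enough; only the summand containing
    1 needs the improvement by one that [lin_syz_gen] provides. *)
Lemma lin_syz_bits t n : (3 * t <= n)%N -> lin_syz (bits t n) t%:Z.
Proof.
elim: t n => [|t IHt] n tn.
  move=> [|j] e a ej Sa a0.
    exists (fun=> 0); split=> // [i|i]; first exact: supported0.
    rewrite leqn0 => /eqP->; rewrite -[LHS]/(binform (P:=bits 0 n) 0 a) a0.
    by rewrite !linear0 addr0.
  exists (fun=> 0); split=> // [i|i ij]; first exact: supported0.
  rewrite !linear0 addr0; apply/funext => l; apply/eqP; apply: contraT.
  by move=> /(Sa i ij) /andP[_ /eqP]; lia.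
case: n tn => [|[|[|n]]] tn; try lia.
have {IHt} Pt : lin_syz (bits t n) t by apply: IHt; lia.
have HM := lin_syz_gen Pt; have HM' := lin_syz_cog Pt.
set P := bits t n in Pt HM HM'; set Q := bits t.+1 n.+3.
have opFE x y z u : head3 x y z (opF Q u) =
    opF P (head3 x y z u) + if x && y then head3 false false z u else 0.
  have -> : opF Q u = pair_op (first_pairs t.+1) u by [].
  rewrite first_pairsS pair_op_head3 addrC.
  by congr (_ + _); apply/funext => l; rewrite /has2 /=; case: (x && y).
have opGE x y z u : head3 x y z (opG Q u) =
    opG P (head3 x y z u) + if y && z then head3 x false false u else 0.
  have -> : opG Q u = pair_op (second_pairs t.+1) u by [].
  rewrite second_pairsS pair_op_head3 addrC.
  by congr (_ + _); apply/funext => l; rewrite /has2 /=; case: (y && z).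
pose toM (u : seq bool -> K^o) : idx (gen_pencil P) -> K^o :=
  unslice (fun c => if c is Some d then head3 d true (~~ d) u
                    else head3 false false false u).
pose toM' (u : seq bool -> K^o) : idx (cog_pencil P) -> K^o :=
  unslice (fun c => if c is Some d then head3 (~~ d) false d u
                    else head3 true true true u).
have toMF u : toM (opF Q u) = opF (gen_pencil P) (toM u).
  apply: slice_eq => c; rewrite slice_block_op; case: c => [[]|];
  by rewrite /toM /slice /unslice /= opFE.
have toMG u : toM (opG Q u) = opG (gen_pencil P) (toM u).
  apply: slice_eq => c; rewrite slice_block_op; case: c => [[]|];
  by rewrite /toM /slice /unslice /= opGE.
have toM'F u : toM' (opF Q u) = opF (cog_pencil P) (toM' u).
  apply: slice_eq => c; rewrite slice_block_op; case: c => [[]|];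
  by rewrite /toM' /slice /unslice /= opFE.
have toM'G u : toM' (opG Q u) = opG (cog_pencil P) (toM' u).
  apply: slice_eq => c; rewrite slice_block_op; case: c => [[]|];
  by rewrite /toM' /slice /unslice /= opGE.
move=> j e a ejt Sa a0.
have Shead i (x y z : bool) : (i <= j)%N ->
    supported (bits_lvl n (e - (x + y + z)%:Z)) (head3 x y z (a i)).
  move=> ij l /(Sa i ij) /andP[/= /eqP[sl] /eqP E].
  by rewrite /bits_lvl sl eqxx /=; apply/eqP; lia.
have [b [b0 bj Sb ab]] : exists b : nat -> idx (gen_pencil P) -> K^o,
    [/\ b 0 = 0, b j.+1 = 0,
      (forall i, supported (lvl (e - 2)) (b i)) &
      forall i, (i <= j)%N -> toM (a i) =
        opG (gen_pencil P) (b i.+1) - opF (gen_pencil P) (b i)].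
  apply: (HM j e); first by lia.
    move=> i ij; apply/supported_slice => -[[]|].
    - exact: (Shead i true true false).
    - exact: (Shead i false true true).
    - exact: (Shead i false false false).
  rewrite -(@binform_morph Q (gen_pencil P) toM) ?a0 // => [|u v];
    by apply: slice_eq => -[[]|].
have [c [c0 cj Sc ac]] : exists c : nat -> idx (cog_pencil P) -> K^o,
    [/\ c 0 = 0, c j.+1 = 0,
      (forall i, supported (lvl (e - 1 - 2)) (c i)) &
      forall i, (i <= j)%N -> toM' (a i) =
        opG (cog_pencil P) (c i.+1) - opF (cog_pencil P) (c i)].
  apply: (HM' j (e - 1)); first by lia.
    move=> i ij; apply/supported_slice => -[[]|].
    - by rewrite /= subr0; apply: (Shead i false false true).
    - by rewrite /= subr0; apply: (Shead i true false false).
    - rewrite (_ : e - 1 - _ = e - 3); last by rewrite /=; ring.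
      exact: (Shead i true true true).
  rewrite -(@binform_morph Q (cog_pencil P) toM') ?a0 // => [|u v];
    by apply: slice_eq => -[[]|].
have [m [m0 mj Sm am]] : exists m : nat -> seq bool -> K^o,
    [/\ m 0 = 0, m j.+1 = 0,
      (forall i, supported (bits_lvl n (e - 1 - 2)) (m i)) &
      forall i, (i <= j)%N -> head3 false true false (a i) =
        opG P (m i.+1) - opF P (m i)].
  apply: (Pt j (e - 1)); first by lia.
    by move=> i ij; apply: (Shead i false true false).
  rewrite -(@binform_morph Q P (head3 false true false)) ?a0 //.
    by move=> u; rewrite opFE addr0.
  by move=> u; rewrite opGE addr0.
have [r [r0 rj Sr ar]] : exists r : nat -> seq bool -> K^o,
    [/\ r 0 = 0, r j.+1 = 0,
      (forall i, supported (bits_lvl n (e - 2 - 2)) (r i)) &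
      forall i, (i <= j)%N -> head3 true false true (a i) =
        opG P (r i.+1) - opF P (r i)].
  apply: (Pt j (e - 2)); first by lia.
    by move=> i ij; apply: (Shead i true false true).
  rewrite -(@binform_morph Q P (head3 true false true)) ?a0 //.
    by move=> u; rewrite opFE addr0.
  by move=> u; rewrite opGE addr0.
pose B i (l : seq bool) : K^o := if l is [:: x, y, z & l'] then
  match x, y, z with
  | false, false, false => b i (l', None)
  | true, true, false => b i (l', Some true)
  | false, true, true => b i (l', Some false)
  | false, false, true => c i (l', Some true)
  | true, false, false => c i (l', Some false)
  | true, true, true => c i (l', None)
  | false, true, false => m i l'
  | true, false, true => r i l'
  end else 0.
have toMB i : toM (B i) = b i by apply: slice_eq => -[[]|].
have toM'B i : toM' (B i) = c i by apply: slice_eq => -[[]|].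
have ext u v : (forall l, (size l < 3)%N -> u l = v l) -> toM u = toM v ->
    toM' u = toM' v -> head3 false true false u = head3 false true false v ->
    head3 true false true u = head3 true false true v -> u = v.
  move=> short EM EM' Em Er; apply/funext => -[|x [|y [|z l]]]; try exact: short.
  move: x y z => [] [] [].
  - exact: (congr1 (@^~ (l, None)) EM').
  - exact: (congr1 (@^~ (l, Some true)) EM).
  - exact: (congr1 (@^~ l) Er).
  - exact: (congr1 (@^~ (l, Some false)) EM').
  - exact: (congr1 (@^~ (l, Some false)) EM).
  - exact: (congr1 (@^~ l) Em).
  - exact: (congr1 (@^~ (l, Some true)) EM').
  - exact: (congr1 (@^~ (l, None)) EM).
have Bshort i l : (size l < 3)%N -> B i l = 0.
  by move: l => [|x [|y [|z l]]].
have toM0 : toM 0 = 0 by apply: slice_eq => -[[]|].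
have toM'0 : toM' 0 = 0 by apply: slice_eq => -[[]|].
have toMsub u v : toM (u - v) = toM u - toM v by apply: slice_eq => -[[]|].
have toM'sub u v : toM' (u - v) = toM' u - toM' v by apply: slice_eq => -[[]|].
have op_short ks i l : (size l < 3)%N -> pair_op ks (B i) l = 0.
  move=> sl; rewrite /pair_op big1 // => k _; case: ifP => // _.
  by rewrite Bshort // size_erase2.
exists B; split.
- apply: ext; rewrite ?toMB ?toM'B ?toM0 ?toM'0 //; exact: Bshort.
- apply: ext; rewrite ?toMB ?toM'B ?toM0 ?toM'0 //; exact: Bshort.
- move=> i [|x [|y [|z l]]]; rewrite ?eqxx // => Bl.
  suff : bits_lvl n (e - 2 - (x + y + z)%:Z) l.
    move=> /andP[/eqP sl /eqP cl]; rewrite /= /bits_lvl /= sl eqxx /=.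
    by apply/eqP; lia.
  have e3 : e - 1 - 2 - 2 = e - 2 - 3 by ring.
  have e1 : e - 1 - 2 = e - 2 - 1 by ring.
  move: x y z Bl => [] [] [] Bl.
  - by have := Sc i (l, None) Bl; rewrite /= /block_lvl /= e3.
  - exact: (Sb i (l, Some true) Bl).
  - exact: (Sr i l Bl).
  - by have := Sc i (l, Some false) Bl; rewrite /= /block_lvl /= e1 subr0.
  - exact: (Sb i (l, Some false) Bl).
  - by rewrite -e1; exact: (Sm i l Bl).
  - by have := Sc i (l, Some true) Bl; rewrite /= /block_lvl /= e1 subr0.
  - exact: (Sb i (l, None) Bl).
move=> i ij; apply: ext.
- move=> l sl; transitivity (0 : K^o).
    by apply/eqP; apply: contraT => /(Sa i ij) /andP[/eqP sl']; rewrite sl' in sl.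
  rewrite -[RHS]/(pair_op (second_pairs t.+1) (B i.+1) l -
    pair_op (first_pairs t.+1) (B i) l).
  by rewrite !op_short // subr0.
- by rewrite toMsub toMF toMG !toMB ab.
- by rewrite toM'sub toM'F toM'G !toM'B ac.
- rewrite am // -[RHS]/(head3 false true false (opG Q (B i.+1)) -
    head3 false true false (opF Q (B i))).
  by rewrite opFE opGE !addr0.
- rewrite ar // -[RHS]/(head3 true false true (opG Q (B i.+1)) -
    head3 true false true (opF Q (B i))).
  by rewrite opFE opGE !addr0.
Qed.
End BitsSyz.

(** * Exactness for a special pair of forms *)

Section Koszul.
Variables (K : numFieldType) (P : pencil K) (t : int).
Hypothesis Pt : lin_syz P t.
Local Notation F := (opF P).
Local Notation G := (opG P).

(** The case j = 1 of [lin_syz]. *)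
Lemma koszul_exact e (u v : idx P -> K^o) : e + 1 <= t ->
  supported (lvl e) u -> supported (lvl e) v -> F u + G v = 0 ->
  exists c, [/\ supported (lvl (e - 2)) c, u = G c & v = - F c].
Proof.
move=> et Su Sv uv; pose a i := if i is 0%N then u else v.
have [||b [b0 b2 Sb ab]] := Pt (j := 1) (e := e) (a := a) et.
- by case.
- exact: uv.
exists (b 1%N); split=> //.
- by have := ab 0%N isT; rewrite b0 linear0 subr0.
- by have := ab 1%N isT; rewrite b2 linear0 sub0r.
Qed.

(** If G kills [u], then (0, u) is a syzygy, so that u = - F c with G c = 0, and
    [c] has smaller degree. *)
Lemma koszul_injective e (u : idx P -> K^o) :
  (forall d x, d < 0 -> ~~ lvl (p := P) d x) -> e + 1 <= t ->
  supported (lvl e) u -> G u = 0 -> u = 0.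
Proof.
move=> lvl_ge0; have [m em] : exists m : nat, e < m%:Z by exists `|e|.+1%N; lia.
elim: m e em u => [|m IHm] e em u et Su Gu.
  apply/funext => x; apply/eqP; apply: contraT => /Su.
  by rewrite (negPf (lvl_ge0 _ _ em)).
have [||c [Sc c0 ->]] := koszul_exact (u := 0) et _ Su.
- exact: supported0.
- by rewrite linear0 add0r.
have -> : c = 0 by apply: (IHm (e - 2)) => //; lia.
by rewrite linear0 oppr0.
Qed.
End Koszul.

Section Hat.
Variables (K : numFieldType) (n : nat).
Local Notation E := (exterior K n).
Implicit Types (u v : E) (l : seq bool) (k : nat).

Definition bits_set l : {set 'I_n} := [set i : 'I_n | nth false l i].
Definition set_bits (A : {set 'I_n}) : seq bool := [seq i \in A | i <- enum 'I_n].

Lemma size_set_bits A : size (set_bits A) = n.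
Proof. by rewrite size_map size_enum_ord. Qed.

Lemma set_bitsK : cancel set_bits bits_set.
Proof.
move=> A; apply/setP => i; rewrite inE (nth_map i) ?size_enum_ord //.
by rewrite nth_ord_enum.
Qed.

Lemma bits_setK l : size l = n -> set_bits (bits_set l) = l.
Proof.
move=> sl; apply: (@eq_from_nth _ false) => [|i]; rewrite size_set_bits ?sl //.
move=> il; rewrite (nth_map (Ordinal il)) ?size_enum_ord // inE.
by rewrite nth_enum_ord.
Qed.

Lemma card_bits_set l : size l = n -> #|bits_set l| = count id l.
Proof.
move=> sl; rewrite -{2}(bits_setK sl) /set_bits count_map.
rewrite cardE [in LHS]/enum_mem size_filter enumT; exact: eq_count.
Qed.

(** Identifies E with functions on lists of [n] bits; by [hat_mul] this turns
    multiplication by a sum of products of adjacent variables into [pair_op]. *)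
Definition hat u : seq bool -> K^o :=
  fun l => if size l == n then u (bits_set l) else 0.

Lemma hat_set_bits u A : hat u (set_bits A) = u A.
Proof. by rewrite /hat size_set_bits eqxx set_bitsK. Qed.

Lemma hat_inj : injective hat.
Proof.
by move=> u v uv; apply/ffunP => A; rewrite -[u A]hat_set_bits uv hat_set_bits.
Qed.

Lemma hatD u v : hat (u + v) = hat u + hat v.
Proof.
apply/funext => l; rewrite fctE /hat; case: ifP => _; last by rewrite addr0.
by rewrite ffunE.
Qed.

Lemma hatN u : hat (- u) = - hat u.
Proof.
apply/funext => l; rewrite fctE /hat; case: ifP => _; last by rewrite oppr0.
by rewrite ffunE.
Qed.

Lemma hat0 : hat 0 = 0.
Proof. by apply/funext => l; rewrite /hat ffunE if_same. Qed.

Definition in_degree (e : int) u := forall A, u A != 0 -> #|A|%:Z = e.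

Lemma supported_hat e u : in_degree e u -> supported (bits_lvl n e) (hat u).
Proof.
move=> eu l; rewrite /hat /bits_lvl.
case: (eqVneq (size l) n) => [sl|_]; rewrite ?eqxx //=.
by move=> uA; rewrite -(eu _ uA) card_bits_set.
Qed.

Lemma hat_surj e (c : seq bool -> K^o) : supported (bits_lvl n e) c ->
  exists2 u, c = hat u & in_degree e u.
Proof.
move=> Sc; exists [ffun A => c (set_bits A)].
  apply/funext => l; rewrite /hat ffunE; case: eqP => [sl|nl].
    by rewrite bits_setK.
  by apply/eqP; apply: contraT => /Sc /andP[/eqP].
move=> A; rewrite ffunE => /Sc /andP[sA /eqP <-].
by rewrite -card_bits_set ?set_bitsK ?(eqP sA).
Qed.

Definition consec k : {set 'I_n} := [set i : 'I_n | (val i == k) || (val i == k.+1)].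

Definition pair_form (ks : seq nat) : E :=
  [ffun B => \sum_(k <- ks) (B == consec k)%:R].

Lemma bits_set_erase2 l k : bits_set (erase2 l k) = bits_set l :\: consec k.
Proof. by apply/setP => i; rewrite !inE nth_erase2 negb_or andbC. Qed.

Lemma consec_sub l k : (k.+1 < n)%N -> (consec k \subset bits_set l) = has2 l k.
Proof.
move=> kn; apply/subsetP/andP => [sub|[lk lk1] i].
  have := sub (Ordinal kn); have := sub (Ordinal (ltnW kn)).
  by rewrite !inE /= !eqxx orbT /= => -> // ->.
by rewrite !inE => /orP[]/eqP->.
Qed.

(** No variable lies strictly between two adjacent ones, so that moving a
    variable past both of them changes the sign twice. *)
Lemma even_inversions (A : {set 'I_n}) k :
  [disjoint A & consec k] -> (k.+1 < n)%N -> ~~ odd (inversions A (consec k)).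
Proof.
move=> dA kn; pose k0 := Ordinal (ltnW kn); pose k1 := Ordinal kn.
have ck : consec k = [set k0; k1].
  by apply/setP => i; rewrite !inE -!val_eqE.
have nA i : i \in A -> (val i != k) && (val i != k.+1).
  by move=> iA; have := disjointFr dA iA; rewrite !inE => /norP/andP.
rewrite /inversions (eq_bigr (fun i : 'I_n => ((k < i)%N * 2)%N)).
  by rewrite -big_distrl /= oddM andbF.
move=> i /nA /andP[ik ik1]; rewrite ck big_setU1 /=; last first.
  by rewrite inE -val_eqE /= neq_ltn ltnSn.
rewrite big_set1 /= muln2 -addnn; congr (_ + _)%N; congr nat_of_bool.
by rewrite [(k < i)%N]leq_eqVlt eq_sym (negPf ik1).
Qed.

Lemma hat_mul u ks : all (fun k => k.+1 < n)%N ks ->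
  hat (u * pair_form ks) = pair_op ks (hat u).
Proof.
move=> /allP ksn; apply/funext => l; rewrite /hat /pair_op.
case: (eqVneq (size l) n) => [sl|nl]; last first.
  rewrite big1 // => k _; rewrite size_erase2 (negPf nl); exact: if_same.
rewrite ffunE.
under eq_bigr => A _ do rewrite ffunE mulr_sumr mulr_sumr.
rewrite exchange_big /= !big_seq; apply: eq_bigr => k kks.
have kn := ksn k kks; rewrite size_erase2 sl eqxx -consec_sub //.
rewrite bits_set_erase2; set C := bits_set l; set p := consec k.
case: ifP => [pC|pC]; last first.
  rewrite big1 // => A AC; case: eqP => [Cp|_]; last by rewrite !mulr0.
  by rewrite -Cp subsetDl in pC.
rewrite (bigD1 (C :\: p)) ?subsetDl //= big1 => [|A /andP[AC nA]].
  rewrite setDDr setDv set0U (setIidPr pC) eqxx mulr1 addr0.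
  rewrite -signr_odd (negPf (even_inversions _ kn)) ?mul1r //.
  by rewrite disjoint_sym disjoints_subset setCD subsetUr.
case: eqP => [Cp|_]; last by rewrite !mulr0.
by case/eqP: nA; rewrite -Cp setDDr setDv set0U (setIidPr AC).
Qed.
End Hat.

Section Special.
Variables (K : numFieldType) (n t : nat).
Hypothesis tn : (3 * t <= n)%N.
Local Notation E := (exterior K n).
Local Notation f0 := (pair_form K n (first_pairs t)).
Local Notation g0 := (pair_form K n (second_pairs t)).
Implicit Types (u v c : E) (e : int).

Lemma first_pairs_lt : all (fun k => k.+1 < n)%N (first_pairs t).
Proof. by rewrite all_map; apply/allP => i; rewrite mem_iota /=; lia. Qed.

Lemma second_pairs_lt : all (fun k => k.+1 < n)%N (second_pairs t).
Proof. by rewrite all_map; apply/allP => i; rewrite mem_iota /=; lia. Qed.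

Lemma in_degree_pair_form ks : all (fun k => k.+1 < n)%N ks ->
  in_degree 2 (pair_form K n ks).
Proof.
move=> /allP ksn A; rewrite ffunE => A0; congr Posz.
have /hasP[k kks /eqP ->] : has (fun k => A == consec n k) ks.
  apply: contraNT A0 => /hasPn nA; rewrite big1_seq // => k /andP[_ /nA].
  by move=> /negPf ->.
have kn := ksn k kks.
rewrite (_ : consec n k = [set Ordinal (ltnW kn); Ordinal kn]).
  by rewrite cards2 -val_eqE /= neq_ltn ltnSn.
by apply/setP => i; rewrite !inE -!val_eqE.
Qed.

Lemma pair_forms_exact e u v : e + 1 <= t%:Z -> in_degree e u -> in_degree e v ->
  u * f0 + v * g0 = 0 ->
  exists c, [/\ in_degree (e - 2) c, u = c * g0 & v = - (c * f0)].
Proof.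
move=> et eu ev uv; have Pt := @lin_syz_bits K t n tn.
have [|||c [Sc uc vc]] := koszul_exact (u := hat u) (v := hat v) Pt et.
- exact: supported_hat.
- exact: supported_hat.
- by rewrite /= -!hat_mul ?first_pairs_lt ?second_pairs_lt // -hatD uv hat0.
have [c' cE ec'] := hat_surj Sc; exists c'; split=> //.
- by apply: hat_inj; rewrite hat_mul ?second_pairs_lt // -cE.
- by apply: hat_inj; rewrite hatN hat_mul ?first_pairs_lt // -cE.
Qed.

Lemma pair_form_regular e u : e + 1 <= t%:Z -> in_degree e u -> u * g0 = 0 -> u = 0.
Proof.
move=> et eu ug; have Pt := @lin_syz_bits K t n tn.
apply: hat_inj; rewrite hat0; apply: (koszul_injective Pt _ et).
- by move=> d l d0; rewrite /= /bits_lvl; apply/negP => /andP[_ /eqP]; lia.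
- exact: supported_hat.
- by rewrite /= -hat_mul ?second_pairs_lt // ug hat0.
Qed.
End Special.

(** * Matrices of the Koszul strand *)

Section Matrices.
Variables (n s : nat).

(** The monomials of degree [s - k], without truncation: there are none when
    [s < k]. *)
Definition level k : {set {set 'I_n}} := [set A : {set 'I_n} | (#|A| + k == s)%N].
Local Notation L k := #|level k|.

(** Right multiplication by the form with coefficients [h], over any ring so as
    to cover forms with indeterminate coefficients. *)
Definition mul_mx (S : pzRingType) (h : {set 'I_n} -> S) k m : 'M[S]_(L k, L m) :=
  \matrix_(i, j) let A : {set 'I_n} := enum_val i in
    let C : {set 'I_n} := enum_val j in
    if A \subset C then (-1) ^+ inversions A (C :\: A) * h (C :\: A) else 0.

(** The maps (a, b) |-> a h1 + b h2 and c |-> (c h2, - c h1), acting on row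
    vectors. *)
Definition koszul_mx (S : pzRingType) (h1 h2 : {set 'I_n} -> S) :=
  col_mx (mul_mx h1 2 0) (mul_mx h2 2 0).
Definition koszul_syz_mx (S : pzRingType) (h1 h2 : {set 'I_n} -> S) :=
  row_mx (mul_mx h2 4 2) (- mul_mx h1 4 2).

Lemma map_mul_mx (S T : pzRingType) (phi : {rmorphism S -> T})
    (h : {set 'I_n} -> S) k m : map_mx phi (mul_mx h k m) = mul_mx (phi \o h) k m.
Proof.
apply/matrixP => i j; rewrite !mxE /=; case: ifP => _; last exact: rmorph0.
by rewrite rmorphM rmorph_sign.
Qed.

Variable (K : fieldType).
Local Notation E := (exterior K n).
Implicit Types (u v : E) (k m : nat).

Definition coords k u : 'rV[K]_(L k) := \row_i u (enum_val i).
Definition of_coords k (v : 'rV[K]_(L k)) : E :=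
  [ffun A => \sum_i (A == enum_val i)%:R * v 0 i].

Definition at_level k u := forall A, u A != 0 -> (#|A| + k = s)%N.

Lemma of_coordsK k : cancel (@of_coords k) (coords k).
Proof.
move=> v; apply/rowP => i; rewrite mxE ffunE (bigD1 i) //= big1.
  by rewrite eqxx mul1r addr0.
by move=> j ji; rewrite (inj_eq enum_val_inj) eq_sym (negPf ji) mul0r.
Qed.

Lemma at_level_of_coords k (v : 'rV[K]_(L k)) : at_level k (of_coords v).
Proof.
move=> A; rewrite ffunE => A0; apply/eqP; apply: contraNT A0 => kA.
rewrite big1 // => i _; case: eqP => [Ai|]; last by rewrite mul0r.
by have := enum_valP i; rewrite -Ai inE (negPf kA).
Qed.

Lemma of_coords_coords k u (A : {set 'I_n}) :
  (#|A| + k)%N = s -> of_coords (coords k u) A = u A.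
Proof.
move=> As; have kA : A \in level k by rewrite inE As.
rewrite ffunE (bigD1 (enum_rank_in kA A)) //= mxE enum_rankK_in // eqxx mul1r.
rewrite big1 ?addr0 // => i iA; case: eqP => [E|]; last by rewrite mul0r.
by case/eqP: iA; apply: (canRL (enum_valK_in kA)); rewrite -E.
Qed.

Lemma coordsK k u : at_level k u -> of_coords (coords k u) = u.
Proof.
move=> ku; apply/ffunP => A; have [uA|/ku/of_coords_coords //] := eqVneq (u A) 0.
rewrite uA; apply/eqP; apply: contraT => oA.
by have := at_level_of_coords oA => /(of_coords_coords u) E; rewrite E uA eqxx in oA.
Qed.

Lemma coords_mul k m u v : at_level k u ->
  coords m (u * v) = coords k u *m mul_mx (S:=K) v k m.
Proof.
move=> ku; apply/rowP => j; rewrite !mxE ffunE.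
rewrite (bigID (fun A => A \in level k)) /= [X in _ + X]big1 ?addr0; last first.
  move=> A /andP[_ kA]; suff -> : u A = 0 by rewrite mul0r mulr0.
  by apply/eqP; apply: contraNT kA => /ku; rewrite inE => ->.
rewrite (eq_bigl (fun A => (A \in level k) && (A \subset enum_val j))); last first.
  by move=> A; rewrite andbC.
rewrite big_mkcondr big_enum_val; apply: eq_bigr => i _; rewrite !mxE /=.
by case: ifP => _; rewrite ?mulr0 // mulrCA.
Qed.
End Matrices.

Section Central.
Variables (K : fieldType) (n : nat).
Local Notation E := (exterior K n).
Implicit Types (u v f g : E) (A B C : {set 'I_n}).

Lemma inversionsC A B : [disjoint A & B] ->
  (inversions A B + inversions B A = #|A| * #|B|)%N.
Proof.
move=> dAB; rewrite /inversions [X in (_ + X)%N]exchange_big -big_split /=.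
rewrite -sum_nat_const; apply: eq_bigr => i iA; rewrite -big_split /= -sum1_card.
apply: eq_bigr => j jB; have : val i != val j.
  by apply: contraTneq jB => /val_inj <-; rewrite (disjointFr dAB iA).
by case: ltngtP.
Qed.

Definition quadratic f := forall A, f A != 0 -> #|A| = 2%N.

(** Exchanging disjoint sets of variables of sizes p and q gives the sign
    (-1)^(p q), which is 1 for p = 2. *)
Lemma quadratic_central f u : quadratic f -> f * u = u * f.
Proof.
move=> qf; apply/ffunP => C; rewrite !ffunE.
rewrite [RHS](reindex_onto (fun A => C :\: A) (fun A => C :\: A)) /=; last first.
  by move=> A sAC; rewrite setDDr setDv set0U (setIidPr sAC).
have subE A : (C :\: A \subset C) && (C :\: (C :\: A) == A) = (A \subset C).
  rewrite subsetDl setDDr setDv set0U /=; exact: (sameP eqP setIidPr).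
apply: eq_big => [A|A sAC]; first by rewrite subE.
rewrite setDDr setDv set0U (setIidPr sAC) [u _ * _]mulrC.
have [->|fA] := eqVneq (f A) 0; first by rewrite !mul0r !mulr0.
congr (_ * _); rewrite -signr_odd -[RHS]signr_odd; congr (_ ^+ nat_of_bool _).
have dA : [disjoint A & C :\: A].
  by rewrite disjoint_sym disjoints_subset; apply/subsetP => i; rewrite !inE => /andP[].
have := congr1 odd (inversionsC dA); rewrite oddD oddM (qf _ fA) /=.
by case: odd; case: odd.
Qed.
End Central.

Section Ranks.
Variables (n s : nat) (K : fieldType).
Local Notation E := (exterior K n).
Implicit Types (f g u : E).
Local Notation L k := #|level n s k|.

Lemma at_level_mul f u k : quadratic f -> at_level s k.+2 u -> at_level s k (u * f).
Proof.
move=> qf ku C; rewrite ffunE => uf.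
have /existsP[A /and3P[sAC /ku kA /qf]] :
    [exists A : {set 'I_n}, [&& A \subset C, u A != 0 & f (C :\: A) != 0]].
  apply: contraNT uf => /existsPn nA; rewrite big1 // => A sAC.
  have := nA A; rewrite sAC /= negb_and !negbK => /orP[] /eqP->.
    by rewrite mul0r mulr0.
  by rewrite !mulr0.
by rewrite cardsD (setIidPr sAC) -kA => fA; have := subset_leq_card sAC; lia.
Qed.

Lemma at_level_eq0 k u : at_level s k u -> coords s k u = 0 -> u = 0.
Proof.
move=> ku u0; rewrite -(coordsK ku) u0; apply/ffunP => A; rewrite !ffunE.
by rewrite big1 // => i _; rewrite mxE mulr0.
Qed.

Implicit Type v : 'rV[K]_(L 2 + L 2).

Definition koszul_val f g v : E :=
  of_coords (lsubmx v) * f + of_coords (rsubmx v) * g.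

Lemma coords_linear k : linear (coords s k : E -> _).
Proof. by move=> c u w; apply/rowP => i; rewrite !mxE !ffunE. Qed.
HB.instance Definition _ k :=
  GRing.isLinear.Build K E _ *:%R (@coords n s K k) (@coords_linear k).

Lemma coords_koszul_val f g v :
  coords s 0 (koszul_val f g v) = v *m koszul_mx (S:=K) s f g.
Proof.
rewrite -[v in RHS]hsubmxK /koszul_mx mul_row_col linearD /=.
by rewrite !(coords_mul _ (k := 2)) ?of_coordsK //; exact: at_level_of_coords.
Qed.

Lemma at_level_koszul_val f g v : quadratic f -> quadratic g ->
  at_level s 0 (koszul_val f g v).
Proof.
move=> qf qg C; rewrite ffunE => fg.
have [uf|] := eqVneq ((of_coords (lsubmx v) * f) C) 0.
  by move: fg; rewrite uf add0r; apply: at_level_mul => //; apply: at_level_of_coords.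
by apply: at_level_mul => //; apply: at_level_of_coords.
Qed.

Lemma koszul_mx_comp f g : quadratic f -> quadratic g ->
  koszul_syz_mx (S:=K) s f g *m koszul_mx (S:=K) s f g = 0.
Proof.
move=> qf qg; rewrite mul_row_col mulNmx; apply/eqP; rewrite subr_eq0; apply/eqP.
apply/row_matrixP => i; rewrite !row_mul.
have kE (h : E) : row i (mul_mx (S:=K) s h 4 2) =
    coords s 2 (of_coords (delta_mx 0 i) * h).
  by rewrite (coords_mul _ (k := 4)) ?of_coordsK -?rowE //; apply: at_level_of_coords.
rewrite !kE -!coords_mul; do ?by apply: at_level_mul => //; apply: at_level_of_coords.
congr coords; rewrite -!mulrA; congr (_ * _); exact: quadratic_central.
Qed.

Lemma koszul_rank_le f g : quadratic f -> quadratic g ->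
  (\rank (koszul_syz_mx (S:=K) s f g) + \rank (koszul_mx (S:=K) s f g) <= L 2 + L 2)%N.
Proof. by move=> qf qg; apply: mulmx0_rank_max; apply: koszul_mx_comp. Qed.
End Ranks.

Section SpecialRanks.
Variables (K : numFieldType) (n s t : nat).
Hypotheses (tn : (3 * t <= n)%N) (st : (s <= t.+1)%N).
Local Notation f0 := (pair_form K n (first_pairs t)).
Local Notation g0 := (pair_form K n (second_pairs t)).
Local Notation L k := #|level n s k|.

Lemma in_degree_quadratic (f : exterior K n) : in_degree 2 f <-> quadratic f.
Proof. by split=> qf A /qf => [[]|->]. Qed.

Lemma at_level_in_degree k (u : exterior K n) :
  at_level s k u <-> in_degree (s%:Z - k%:Z) u.
Proof. by split=> ku A /ku; lia. Qed.

Lemma special_syz_rank : \rank (koszul_syz_mx (S:=K) s f0 g0) = L 4.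
Proof.
apply/eqP; apply: inj_row_free => v; rewrite mul_mx_row => v0.
have {v0} vg : v *m mul_mx (S:=K) s g0 4 2 = 0.
  by have := congr1 lsubmx v0; rewrite row_mxKl linear0.
have lv := @at_level_of_coords _ _ _ _ v.
have qg : quadratic g0.
  exact/in_degree_quadratic/in_degree_pair_form/(second_pairs_lt tn).
suff v0 : of_coords v = 0 by rewrite -[v]of_coordsK v0 linear0.
have e4 : in_degree (s%:Z - 4) (of_coords v) by apply/at_level_in_degree.
apply: (pair_form_regular tn _ e4); first by lia.
apply: (@at_level_eq0 _ s _ 2); first exact: at_level_mul.
by rewrite (coords_mul _ _ lv) of_coordsK.
Qed.

(** A vector in the kernel is a syzygy of the special pair, hence in the image of
    the previous map. *)
Lemma special_rank : (L 2 + L 2 <= \rank (koszul_mx (S:=K) s f0 g0) + L 4)%N.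
Proof.
have qf : quadratic f0.
  exact/in_degree_quadratic/in_degree_pair_form/(first_pairs_lt tn).
have qg : quadratic g0.
  exact/in_degree_quadratic/in_degree_pair_form/(second_pairs_lt tn).
rewrite -leq_subLR -special_syz_rank -mxrank_ker; apply: mxrankS; apply/row_subP => i.
have : row i (kermx (koszul_mx (S:=K) s f0 g0)) *m koszul_mx (S:=K) s f0 g0 = 0.
  by rewrite -row_mul mulmx_ker row0.
move: (row i _) => v; rewrite -coords_koszul_val => v0.
have {v0} uv : koszul_val f0 g0 v = 0.
  by apply: at_level_eq0 v0; apply: at_level_koszul_val.
have lu := @at_level_of_coords _ _ _ _ (lsubmx v).
have lw := @at_level_of_coords _ _ _ _ (rsubmx v).
have [|||c [lc uc wc]] := pair_forms_exact tn (e := s%:Z - 2) _ _ _ uv.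
- by lia.
- exact/at_level_in_degree.
- exact/at_level_in_degree.
have {}lc : at_level s 4 c.
  by apply/at_level_in_degree; rewrite (_ : s%:Z - 4 = s%:Z - 2 - 2) //; ring.
apply/submxP; exists (coords s 4 c); rewrite mul_mx_row mulmxN -!coords_mul //.
rewrite -uc -linearN -wc -[LHS]hsubmxK.
by rewrite -[lsubmx v in LHS]of_coordsK -[rsubmx v in LHS]of_coordsK.
Qed.
End SpecialRanks.

(** * From special to generic forms *)

(** If [B] and [C] are matrices over [F1] such that B A C specializes under [phi]
    to the identity of size the rank, then the determinant of B A C, formed over
    [R], does not vanish under [phi], hence is nonzero, hence does not vanish
    under [psi]. *)
Lemma rank_specialize (R : comNzRingType) (F1 F2 : fieldType)
    (phi : {rmorphism R -> F1}) (iota : {rmorphism F1 -> R})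
    (psi : {rmorphism R -> F2}) (m p : nat) (A : 'M[R]_(m, p)) :
  cancel iota phi -> (forall x, psi x = 0 -> x = 0) ->
  (\rank (map_mx phi A) <= \rank (map_mx psi A))%N.
Proof.
move=> iotaK psi0; set M := map_mx phi A.
pose B := pinvmx (col_base M); pose C := pinvmx (row_base M).
have BMC : B *m M *m C = 1%:M.
  have -> : B *m M = row_base M.
    rewrite -[RHS]mul1mx -(mulVpmx (col_base_full M)) -[in RHS]mulmxA.
    by rewrite mulmx_base.
  by rewrite mulmxVp // row_base_free.
have mapK k l (D : 'M[F1]_(k, l)) : map_mx phi (map_mx iota D) = D.
  by apply/matrixP => i j; rewrite !mxE iotaK.
pose d := \det (map_mx iota B *m A *m map_mx iota C).
have d0 : d != 0.
  have : phi d != 0 by rewrite -det_map_mx !map_mxM !mapK BMC det1 oner_neq0.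
  by apply: contra_neq => ->; rewrite rmorph0.
have {d0} : psi d != 0 by apply: contra_neq d0 => /psi0.
rewrite -det_map_mx !map_mxM -unitfE -unitmxE => /mxrank_unit <-.
by apply: leq_trans (mxrankM_maxl _ _) _; apply: mxrankM_maxr.
Qed.

Section Generic.
Variables n s : nat.
Local Notation Q := (quad_mono n + quad_mono n)%type.
Local Notation PR := {mpoly rat[#|{: Q}|]}.

Section Eval.
Variables (K : numFieldType) (c : Q -> K).
(** The evaluation that appears in the definition of algebraic independence. *)
Definition coef_eval (p : PR) : K := (map_mpoly ratr p).@[fun i => c (enum_val i)].
Lemma coef_eval_additive : zmod_morphism coef_eval.
Proof. by move=> p q; rewrite /coef_eval rmorphB mevalB. Qed.
Lemma coef_eval_multiplicative : monoid_morphism coef_eval.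
Proof.
by split=> [|p q]; rewrite /coef_eval ?rmorph1 ?meval1 // rmorphM mevalM.
Qed.
HB.instance Definition _ :=
  GRing.isZmodMorphism.Build PR K coef_eval coef_eval_additive.
HB.instance Definition _ :=
  GRing.isMonoidMorphism.Build PR K coef_eval coef_eval_multiplicative.

Lemma coef_evalX m : coef_eval 'X_(enum_rank m) = c m.
Proof. by rewrite /coef_eval map_mpolyX mevalXU enum_rankK. Qed.

Lemma coef_evalC a : coef_eval a%:MP = ratr a.
Proof. by rewrite /coef_eval map_mpolyC mevalC. Qed.
End Eval.

(** The quadratic form whose coefficients are the indeterminates attached to one
    of the two copies of the quadratic monomials. *)
Definition generic_form (side : quad_mono n -> Q) (B : {set 'I_n}) : PR :=
  if insub B is Some m then 'X_(enum_rank (side m)) else 0.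

Section EvalMatrices.
Variables (K : numFieldType) (f g : exterior K n).
Hypotheses (qf : quadratic f) (qg : quadratic g).
Local Notation ev := (coef_eval (quad_coefs f g)).

Lemma eval_generic_inl : ev \o generic_form inl = f :> ({set 'I_n} -> K).
Proof.
apply/funext => B; rewrite /= /generic_form; case: insubP => [m _ mB|B2].
  by rewrite coef_evalX /= mB.
by rewrite rmorph0; apply/esym/eqP; apply: contraNT B2 => /qf ->.
Qed.

Lemma eval_generic_inr : ev \o generic_form inr = g :> ({set 'I_n} -> K).
Proof.
apply/funext => B; rewrite /= /generic_form; case: insubP => [m _ mB|B2].
  by rewrite coef_evalX /= mB.
by rewrite rmorph0; apply/esym/eqP; apply: contraNT B2 => /qg ->.
Qed.

Lemma eval_koszul_mx :
  map_mx ev (koszul_mx s (generic_form inl) (generic_form inr)) =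
  koszul_mx (S:=K) s f g.
Proof.
by rewrite /koszul_mx map_col_mx !map_mul_mx eval_generic_inl eval_generic_inr.
Qed.

Lemma eval_koszul_syz_mx :
  map_mx ev (koszul_syz_mx s (generic_form inl) (generic_form inr)) =
  koszul_syz_mx (S:=K) s f g.
Proof.
rewrite /koszul_syz_mx map_row_mx map_mxN !map_mul_mx.
by rewrite eval_generic_inl eval_generic_inr.
Qed.
End EvalMatrices.

(** Both ranks are at least the special ones, and their sum is at most the
    dimension of the middle term because the composite vanishes. *)
Lemma generic_rank (K : numFieldType) (f g : exterior K n) t :
  (3 * t <= n)%N -> (s <= t.+1)%N -> quadratic f -> quadratic g ->
  alg_independent (quad_coefs f g) ->
  (\rank (koszul_mx (S:=K) s f g) + #|level n s 4| = #|level n s 2| + #|level n s 2|)%N.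
Proof.
move=> tn st qf qg indep.
pose f0 := pair_form rat n (first_pairs t); pose g0 := pair_form rat n (second_pairs t).
have qf0 : quadratic f0.
  exact/in_degree_quadratic/in_degree_pair_form/(first_pairs_lt tn).
have qg0 : quadratic g0.
  exact/in_degree_quadratic/in_degree_pair_form/(second_pairs_lt tn).
have CK : cancel (@mpolyC #|{: Q}| rat) (coef_eval (quad_coefs f0 g0)).
  by move=> a; rewrite coef_evalC /ratr divq_num_den.
have le k l (A : 'M[PR]_(k, l)) :
    (\rank (map_mx (coef_eval (quad_coefs f0 g0)) A) <=
     \rank (map_mx (coef_eval (quad_coefs f g)) A))%N.
  apply: (@rank_specialize _ _ _ (coef_eval (quad_coefs f0 g0))
    (@mpolyC #|{: Q}| rat) (coef_eval (quad_coefs f g)) _ _ A CK).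
  exact: indep.
have := le _ _ (koszul_syz_mx s (generic_form inl) (generic_form inr)).
rewrite !eval_koszul_syz_mx // (special_syz_rank rat tn st).
have := le _ _ (koszul_mx s (generic_form inl) (generic_form inr)).
rewrite !eval_koszul_mx //.
have := special_rank rat tn st; have := koszul_rank_le s qf qg.
rewrite -/f0 -/g0 => le2 ge2 le_rank le_syz.
apply/eqP; rewrite eqn_leq; apply/andP; split.
  by rewrite addnC; apply: leq_trans le2; rewrite leq_add2r.
by apply: leq_trans ge2 _; rewrite leq_add2r.
Qed.
End Generic.

(** * The degree [s] part of the quotient *)

Section Dimension.
Variables (K : fieldType) (n : nat).
Local Notation E := (exterior K n).
Implicit Types (f g u : E).

Lemma dim_limg_mulmxr (a b : nat) (M : 'M[K]_(a, b)) :
  \dim (limg (linfun (mulmxr M : 'rV_a -> 'rV_b))) = \rank M.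
Proof.
pose N := row_base M; pose h := linfun (mulmxr N : 'rV_(\rank M) -> 'rV_b).
have -> : limg (linfun (mulmxr M : 'rV_a -> 'rV_b)) = limg h.
  apply/vspaceP => w; apply/memv_imgP/memv_imgP => -[v _ ->]; rewrite lfunE /=.
    have /submxP[v' E] : (v *m M <= N)%MS by rewrite eq_row_base submxMl.
    by exists v'; rewrite ?memvf // lfunE.
  have /submxP[v' E] : (v *m N <= M)%MS.
    by rewrite (submx_trans (submxMl _ _)) ?eq_row_base.
  by exists v'; rewrite ?memvf // lfunE.
rewrite limg_dim_eq; first by rewrite dimvf dim_matrix mul1r.
apply/eqP; rewrite -subv0; apply/subvP => v; rewrite memv_cap memv_ker memv0.
by rewrite lfunE /= mulmx_free_eq0 ?row_base_free // => /andP[].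
Qed.

Definition coef_at (A : {set 'I_n}) (u : E) : K^o := u A.
Lemma coef_at_linear A : linear (coef_at A).
Proof. by move=> c u v; rewrite /coef_at !ffunE. Qed.
HB.instance Definition _ A :=
  GRing.isLinear.Build K E K^o *:%R (coef_at A) (coef_at_linear A).

Lemma mem_ext_homog d u :
  reflect (forall A, u A != 0 -> #|A| = d) (u \in ext_homog K n d).
Proof.
apply: (iffP idP) => [ud A|du].
  apply: contraNeq => Ad.
  have sub : (ext_homog K n d <= lker (linfun (coef_at A)))%VS.
    apply/span_subvP => _ /imageP[B + ->]; rewrite inE => /eqP Bd.
    rewrite memv_ker lfunE /= /coef_at ffunE; case: (eqVneq A B) => // AB.
    by rewrite AB Bd eqxx in Ad.
  by have := subvP sub u ud; rewrite memv_ker lfunE.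
have -> : u = \sum_A u A *: ext_mono K A.
  apply/ffunP => B; rewrite sum_ffunE (bigD1 B) //= big1 => [|A AB].
    by rewrite !ffunE eqxx /GRing.scale /= mulr1 addr0.
  by rewrite !ffunE eq_sym (negPf AB) scaler0.
apply: memv_suml => A _; have [->|uA] := eqVneq (u A) 0.
  by rewrite scale0r mem0v.
by rewrite memvZ // memv_span //; apply: image_f; rewrite inE du.
Qed.

Variables s : nat.
Local Notation L k := #|level n s k|.

Lemma of_coords_linear k : linear (@of_coords n s K k).
Proof.
move=> c u v; apply/ffunP => A; rewrite !ffunE scaler_sumr -big_split /=.
by apply: eq_bigr => i _; rewrite !mxE /GRing.scale /=; ring.
Qed.
HB.instance Definition _ k :=
  GRing.isLinear.Build K _ E *:%R (@of_coords n s K k) (@of_coords_linear k).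

Lemma koszul_val_linear f g : linear (@koszul_val n s K f g).
Proof.
move=> c u v; rewrite /koszul_val !linearP /= !mulrDl -!scalerAl.
by rewrite scalerDr addrACA.
Qed.
HB.instance Definition _ f g :=
  GRing.isLinear.Build K _ E *:%R (@koszul_val n s K f g) (@koszul_val_linear f g).

Lemma at_level0 u : reflect (at_level s 0 u) (u \in ext_homog K n s).
Proof.
apply: (iffP (mem_ext_homog s u)) => su A /su; first by rewrite addn0.
by rewrite addn0.
Qed.

Lemma dim_coords (U : {vspace E}) : (U <= ext_homog K n s)%VS ->
  \dim (linfun (coords s 0) @: U) = \dim U.
Proof.
move=> sU; apply: limg_dim_eq; apply/eqP; rewrite -subv0; apply/subvP => u.
rewrite memv_cap memv_ker memv0 lfunE => /andP[/(subvP sU)/at_level0 lu /eqP].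
by move=> /(at_level_eq0 lu) ->.
Qed.

Lemma dim_ext_homog : \dim (ext_homog K n s) = 'C(n, s).
Proof.
rewrite -dim_coords //.
have -> : (linfun (coords s 0 : E -> _) @: ext_homog K n s = fullv)%VS.
  apply/eqP; rewrite eqEsubv subvf; apply/subvP => v _; apply/memv_imgP.
  exists (of_coords v); last by rewrite lfunE /= of_coordsK.
  by apply/at_level0; apply: at_level_of_coords.
rewrite dimvf dim_matrix mul1r -[in RHS](card_ord n) -card_draws.
by apply: eq_card => A; rewrite !inE addn0.
Qed.

Lemma mul_truncate f (a : E) (C : {set 'I_n}) : quadratic f -> #|C| = s ->
  (a * f) C = (of_coords (coords s 2 a) * f) C.
Proof.
move=> qf Cs; rewrite !ffunE; apply: eq_bigr => A sAC.
have [->|/qf fA] := eqVneq (f (C :\: A)) 0; first by rewrite !mulr0.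
rewrite of_coords_coords //; move: fA; rewrite cardsD (setIidPr sAC).
by have := subset_leq_card sAC; lia.
Qed.

(** As [f] and [g] are central, the ideal consists of the a f + b g.  Such an
    element of degree [s] does not change when [a] and [b] are replaced by their
    parts of degree [s - 2]. *)
Lemma ideal_homog f g : quadratic f -> quadratic g ->
  (ext_homog K n s :&: ext_ideal [:: f; g] = limg (linfun (@koszul_val n s K f g)))%VS.
Proof.
move=> qf qg; pose W := (limg (amulr f) + limg (amulr g))%VS.
have memW a b : a * f + b * g \in W.
  by apply: memv_add; apply/memv_imgP; [exists a | exists b];
    rewrite ?memvf // lfunE.
have WP u : u \in W -> exists a b, u = a * f + b * g.
  move=> /memv_addP[_ /memv_imgP[a _ ->] [_ /memv_imgP[b _ ->] ->]].
  by exists a, b; rewrite !lfunE.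
have sW : (ext_ideal [:: f; g] <= W)%VS.
  apply/prodvP => w v /[swap] _ fw; have /WP[a [b ->]] : w \in W.
    apply: subvP fw; apply/prodvP => a h _.
    rewrite span_cons span_seq1 => /memv_addP[_ /vlineP[c ->] [_ /vlineP[d ->] ->]].
    by rewrite mulrDr -!scalerAr !scalerAl memW.
  rewrite mulrDl -!mulrA (quadratic_central v qf) (quadratic_central v qg).
  by rewrite !mulrA memW.
apply/vspaceP => u; apply/idP/memv_imgP.
  rewrite memv_cap => /andP[/at_level0 su /(subvP sW)/WP[a [b uE]]].
  exists (row_mx (coords s 2 a) (coords s 2 b)); rewrite ?memvf // lfunE /=.
  apply/ffunP => C; have [Cs|Cs] := eqVneq #|C| s.
    rewrite uE /koszul_val row_mxKl row_mxKr [in RHS]ffunE.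
    by rewrite -(mul_truncate a qf Cs) -(mul_truncate b qg Cs) ffunE.
  set w := koszul_val _ _ _; transitivity (0 : K).
    by apply/eqP; apply: contraNT Cs => /su <-; rewrite addn0.
  apply/esym/eqP; apply: contraNT Cs.
  by move=> /(at_level_koszul_val qf qg) <-; rewrite addn0.
move=> [v _ ->]; rewrite lfunE memv_cap /=; apply/andP; split.
  by apply/at_level0; apply: at_level_koszul_val.
rewrite /koszul_val -[X in X + _]mulr1 -[X in _ + X]mulr1.
by apply: memvD; apply: memv_mul; rewrite ?memvf //; apply: memv_mul;
  rewrite ?memvf // memv_span // !inE eqxx ?orbT.
Qed.

Lemma dim_quot_homog f g : quadratic f -> quadratic g ->
  (\dim (ext_quot_homog (ext_ideal [:: f; g]) s) + \rank (koszul_mx (S:=K) s f g)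
   = 'C(n, s))%N.
Proof.
move=> qf qg; rewrite -dim_ext_homog.
rewrite -(limg_ker_dim (linfun (vquot_pi (ext_ideal [:: f; g]))) (ext_homog K n s)).
rewrite addnC; congr (_ + _)%N.
have -> : (lker (linfun (vquot_pi (ext_ideal [:: f; g]))) = ext_ideal [:: f; g])%VS.
  apply/vspaceP => u; rewrite memv_ker lfunE /=.
  by rewrite -(linear0 (vquot_pi (ext_ideal [:: f; g]))) vquot_eq subr0.
rewrite ideal_homog // -dim_coords; last first.
  by rewrite -ideal_homog // capvSl.
rewrite -limg_comp; pose M : 'M[K]_(L 2 + L 2, L 0) := koszul_mx (S:=K) s f g.
transitivity (\dim (limg (linfun (mulmxr M : 'rV_(L 2 + L 2) -> 'rV_(L 0))))).
  by rewrite dim_limg_mulmxr.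
congr (\dim _); congr (_ @: _)%VS.
apply/lfunP => v; rewrite comp_lfunE !lfunE /=; exact/esym/coords_koszul_val.
Qed.
End Dimension.

Lemma card_level n s k : #|level n s k| = binomz n (s%:Z - k%:Z).
Proof.
have [ks|sk] := leqP k s.
  rewrite (_ : s%:Z - k%:Z = (s - k)%N); last by lia.
  rewrite /= -[in RHS](card_ord n) -card_draws; apply: eq_card => A.
  by rewrite !inE -[RHS](eqn_add2r k) subnK.
rewrite (_ : s%:Z - k%:Z = Negz (k - s).-1); last by lia.
by rewrite /= eq_card0 // => A; rewrite !inE gtn_eqF // (leq_trans sk) ?leq_addl.
Qed.

Theorem proposition7 (R : realType) (n s : nat) (hn : (1 <= n)%N)
    (hs : (s <= n %/ 3 + 1)%N) (f g : exterior R[i] n)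
    (hfg : generic_quadratic_forms f g) :
  \dim (ext_quot_homog (ext_ideal [:: f; g]) s) = lattice_paths n s
  /\ (lattice_paths n s)%:Z
    = (binomz n s%:Z)%:Z - 2 * (binomz n (s%:Z - 2))%:Z
      + (binomz n (s%:Z - 4))%:Z.
Proof.
have paths : (lattice_paths n s)%:Z = (binomz n s%:Z)%:Z
    - 2 * (binomz n (s%:Z - 2))%:Z + (binomz n (s%:Z - 4))%:Z.
  by apply: lattice_paths_binomz; lia.
split=> //; apply/eqP; rewrite -eqz_nat paths; apply/eqP.
case: hfg => /mem_ext_homog qf /mem_ext_homog qg indep.
have tn : (3 * (n %/ 3) <= n)%N by lia.
have st : (s <= (n %/ 3).+1)%N by rewrite -addn1.
have [r dimE rankE] : exists2 r,
    (\dim (ext_quot_homog (ext_ideal [:: f; g]) s) + r = 'C(n, s))%N &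
    (r + #|level n s 4| = #|level n s 2| + #|level n s 2|)%N.
  exists (\rank (koszul_mx (S:=R[i]) s f g)); first exact: dim_quot_homog.
  exact: generic_rank tn st qf qg indep.
move: rankE; rewrite !card_level /= -dimE => /(congr1 Posz).
rewrite !PoszD => rankZ.
have -> : 2 * (binomz n (s%:Z - 2))%:Z = r%:Z + (binomz n (s%:Z - 4))%:Z :> int.
  by rewrite rankZ; ring.
by ring.
Qed.
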